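(* Let $H$ be a fixed graph on $k$ vertices that admits a nice coloring. There is a combinatorial (randomized) algorithm that, given an $n$-vertex graph $G$ and a value $t$ that upper bounds the number of copies of $H$ in $G$, decides whether $G$ contains a triangle, in time $\tilde O\big(n^{3-\frac{1}{2^{k-1}}}+n^{3-\frac{k}{2^k-1}}\cdot t^{\frac{1}{2^k-1}}\big)$ if $H$ is triangle-free, and $\tilde O\big(n^{3-\frac{1}{2^{k-4}}}+n^{3-\frac{k-3}{2^{k-3}-1}}\cdot t^{\frac{1}{2^{k-3}-1}}\big)$ if $H$ contains a triangle. The algorithm succeeds with probability $1-O(1/n)$.
   Context: A copy of $H$ in $G$ is an injective map $\phi:V(H)\to V(G)$ with $\phi(x)\phi(y)\in E(G)$ for all $xy\in E(H)$; the number of copies is the number of such maps. A proper $3$-coloring of $H$ is nice if, by repeatedly deleting vertices whose neighborhood is monochromatic until none remain, the leftover graph is empty or a triangle. A ''combinatorial'' algorithm does not use fast matrix multiplication. $\tilde O$ hides polylogarithmic factors in $n$; $k$ is a constant. *)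

(* Defs.v *)
From HB Require Import structures.
From mathcomp Require Import all_boot all_order all_algebra.
From mathcomp Require Import reals exp.

Set Implicit Arguments.
Unset Strict Implicit.
Unset Printing Implicit Defensive.

Import Order.TTheory GRing.Theory Num.Theory.

(** * Graphs *)

Definition simple_graph (V : Type) (e : rel V) : Prop :=
  symmetric e /\ irreflexive e.

Definition has_triangle (V : finType) (e : rel V) : bool :=
  [exists x, exists y, exists z, [&& e x y, e y z & e z x]].

Definition is_copy (k : nat) (h : rel 'I_k) (V : finType) (e : rel V)
    (phi : {ffun 'I_k -> V}) : bool :=
  injectiveb phi && [forall x, forall y, h x y ==> e (phi x) (phi y)].

Definition num_copies (k : nat) (h : rel 'I_k) (V : finType) (e : rel V) : nat :=
  #|[pred phi : {ffun 'I_k -> V} | is_copy h e phi]|.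

(** * Nice colorings *)

Definition proper_coloring (W : finType) (h : rel W) (col : W -> 'I_3) : Prop :=
  forall x y, h x y -> col x != col y.

(* An isolated vertex of the graph induced on [S] counts as having a
   monochromatic neighborhood. *)
Definition mono_nbhd (W : finType) (h : rel W) (col : W -> 'I_3)
    (S : {set W}) (x : W) : Prop :=
  forall y z, y \in S -> z \in S -> h x y -> h x z -> col y = col z.

Inductive deletes_to (W : finType) (h : rel W) (col : W -> 'I_3) :
    {set W} -> {set W} -> Prop :=
| deletes_refl (S : {set W}) : deletes_to h col S S
| deletes_step (S S' : {set W}) (x : W) :
    x \in S -> mono_nbhd h col S x ->
    deletes_to h col (S :\ x) S' -> deletes_to h col S S'.

Definition is_triangle_on (W : finType) (h : rel W) (S : {set W}) : Prop :=
  #|S| = 3 /\ (forall x y, x \in S -> y \in S -> x != y -> h x y).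

(* Deleting a vertex only shrinks the other neighborhoods, so the leftover set
   does not depend on the order of the deletions. *)
Definition nice_coloring (W : finType) (h : rel W) (col : W -> 'I_3) : Prop :=
  proper_coloring h col /\
  exists S : {set W},
    [/\ deletes_to h col [set: W] S,
        forall x, x \in S -> ~ mono_nbhd h col S x
      & S = set0 \/ is_triangle_on h S].

Definition has_nice_coloring (W : finType) (h : rel W) : Prop :=
  exists col : W -> 'I_3, nice_coloring h col.

(** * Combinatorial randomized algorithms

   "Combinatorial" has no agreed formal definition.  It is rendered here by a
   machine on which fast matrix multiplication is not available: its memory
   consists of the registers named in the program text -- a constant number of
   them, with no indirect addressing -- and each holds a machine word, a vertex
   or a set of vertices.  There are no arrays, so no table of intermediate
   values indexed by pairs of vertices can be formed.  Vertices are opaque (no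
   numbering, no arithmetic on them) and are obtained only as uniformly random
   elements of sets of vertices; the input graph is accessed only through
   adjacency tests and neighborhoods.

   Up to logarithmic factors each instruction can be carried out within its
   cost on a word RAM, with a set of vertices stored as a bit vector. *)

Inductive nexp : Type :=
| ereg of nat
| econst of nat
| eadd of nexp & nexp
| esub of nexp & nexp
| emul of nexp & nexp
| ediv of nexp & nexp.

Inductive sexp : Type :=
| sreg of nat
| sempty
| sall
| ssingle of nat
| snbhd of nat
| sunion of sexp & sexp
| sinter of sexp & sexp
| sdiff of sexp & sexp.

Inductive bexp : Type :=
| ble of nexp & nexp
| bedge of nat & nat
| bmem of nat & nat
| bnot of bexp
| band of bexp & bexp.

Inductive cmd : Type :=
| cskip
| cnum of nat & nexp
| crand of nat & nexp
| ccard of nat & sexp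
| cset of nat & sexp
| cpick of nat & sexp
| cseq of cmd & cmd
| cif of bexp & cmd & cmd
| cwhile of bexp & cmd.

(* [word_exp] fixes the constant in the word length, see [word_bound]. *)
Record program : Type := Program { body : cmd; word_exp : nat }.

(* A vertex register may be empty ([None]). *)
Record state (V : finType) : Type := State {
  num : nat -> nat;
  vtx : nat -> option V;
  vset : nat -> {set V}
}.

Definition upd (A : Type) (f : nat -> A) (i : nat) (a : A) : nat -> A :=
  fun j => if j == i then a else f j.

Definition set_num V (s : state V) i a := State (upd (num s) i a) (vtx s) (vset s).
Definition set_vtx V (s : state V) i a := State (num s) (upd (vtx s) i a) (vset s).
Definition set_vset V (s : state V) i a := State (num s) (vtx s) (upd (vset s) i a).

(* Words have O(log (n + t)) bits; results that do not fit saturate at [B]. *)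
Definition word_bound (c n t : nat) : nat := (n + t + 2) ^ c.

Fixpoint neval (B : nat) (V : finType) (s : state V) (a : nexp) : nat :=
  minn B match a with
         | ereg i => num s i
         | econst c => c
         | eadd a1 a2 => neval B s a1 + neval B s a2
         | esub a1 a2 => neval B s a1 - neval B s a2
         | emul a1 a2 => neval B s a1 * neval B s a2
         | ediv a1 a2 => neval B s a1 %/ neval B s a2
         end.

Fixpoint seval (V : finType) (e : rel V) (s : state V) (a : sexp) : {set V} :=
  match a with
  | sreg i => vset s i
  | sempty => set0
  | sall => [set: V]
  | ssingle i => if vtx s i is Some v then [set v] else set0
  | snbhd i => if vtx s i is Some v then [set w | e v w] else set0
  | sunion a1 a2 => seval e s a1 :|: seval e s a2
  | sinter a1 a2 => seval e s a1 :&: seval e s a2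
  | sdiff a1 a2 => seval e s a1 :\: seval e s a2
  end.

Fixpoint beval (B : nat) (V : finType) (e : rel V) (s : state V) (b : bexp) : bool :=
  match b with
  | ble a1 a2 => neval B s a1 <= neval B s a2
  | bedge i j =>
      match vtx s i, vtx s j with Some v, Some w => e v w | _, _ => false end
  | bmem i j => if vtx s i is Some v then v \in vset s j else false
  | bnot b1 => ~~ beval B e s b1
  | band b1 b2 => beval B e s b1 && beval B e s b2
  end.

(* The expressions in a program have constant size, so the cost of an
   instruction does not depend on them. *)
Definition cost (V : finType) (c : cmd) : nat :=
  match c with
  | ccard _ _ | cset _ _ | cpick _ _ => #|V|.+1
  | _ => 1
  end.

(* The execution of [c] has [arity B e c s] equally likely outcomes, numbered
   from 0: [crand i a] stores a uniform element of {0, ..., a - 1} and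
   [cpick i a] a uniform element of the set [a] ([None] if it is empty). *)
Definition arity (B : nat) (V : finType) (e : rel V) (c : cmd) (s : state V) : nat :=
  match c with
  | crand _ a => maxn 1 (neval B s a)
  | cpick _ a => maxn 1 #|seval e s a|
  | _ => 1
  end.

(* [outcome B e c K s r] is the list of commands that remain to be executed,
   and the state, after outcome [r] of [c] followed by the commands [K]. *)
Definition outcome (B : nat) (V : finType) (e : rel V) (c : cmd) (K : seq cmd)
    (s : state V) (r : nat) : seq cmd * state V :=
  match c with
  | cskip => (K, s)
  | cnum i a => (K, set_num s i (neval B s a))
  | crand i _ => (K, set_num s i r)
  | ccard i a => (K, set_num s i (minn B #|seval e s a|))
  | cset i a => (K, set_vset s i (seval e s a))
  | cpick i a => (K, set_vtx s i (onth (enum (seval e s a)) r))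
  | cseq c1 c2 => (c1 :: c2 :: K, s)
  | cif b c1 c2 => ((if beval B e s b then c1 else c2) :: K, s)
  | cwhile b c1 => (if beval B e s b then c1 :: c :: K else K, s)
  end.

(* [runs_within B e T x]: every run from [x], whatever its random choices,
   halts with total cost at most [T]. *)
Inductive runs_within (B : nat) (V : finType) (e : rel V) :
    nat -> seq cmd * state V -> Prop :=
| runs_halted T s : runs_within B e T ([::], s)
| runs_step T c K s :
    cost V c <= T ->
    (forall r, r < arity B e c s ->
       runs_within B e (T - cost V c) (outcome B e c K s r)) ->
    runs_within B e T (c :: K, s).

Definition answer (V : finType) (s : state V) : bool := num s 0 != 0.

(* Probability that a run from [x] halts with answer [b] in at most [m] steps.
   Every step costs at least 1, so under [runs_within B e m x] this is the
   probability of the answer [b]. *)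
Fixpoint prob_answer (R : realType) (B : nat) (V : finType) (e : rel V)
    (b : bool) (m : nat) (x : seq cmd * state V) : R :=
  match x, m with
  | ([::], s), _ => (answer s == b)%:R
  | (c :: K, s), 0 => 0
  | (c :: K, s), m'.+1 =>
      (\sum_(r < arity B e c s) prob_answer R B e b m' (outcome B e c K s r))
        / (arity B e c s)%:R
  end%R.

(* The inputs [n = #|V|] and [t] are in the numeric registers 0 and 1. *)
Definition init_config (P : program) (V : finType) (t : nat) : seq cmd * state V :=
  ([:: body P],
   State (upd (upd (fun=> 0) 0 #|V|) 1 t) (fun=> None) (fun=> set0)).

Definition prog_bound (P : program) (V : finType) (t : nat) : nat :=
  word_bound (word_exp P) #|V| t.

Definition halts_in (P : program) (V : finType) (e : rel V) (t T : nat) : Prop :=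
  runs_within (prog_bound P V t) e T (init_config P V t).

Definition answer_prob (R : realType) (P : program) (V : finType) (e : rel V)
    (t T : nat) (b : bool) : R :=
  prob_answer R (prog_bound P V t) e b T (init_config P V t).

(** * The running time *)

Local Open Scope ring_scope.

(* In the degenerate cases [k = 0], and [k = 3] with a triangle, the exponents
   0 / 0 and 1 / 0 are 0 by MathComp's convention, and [0 `^ 0] is 1, so the
   second summand is [n ^ 3]. *)
Definition time_bound (R : realType) (k : nat) (tri : bool) (n t : R) : R :=
  let k := k%:R in
  if tri then
    n `^ (3 - 1 / 2 `^ (k - 4))
    + n `^ (3 - (k - 3) / (2 `^ (k - 3) - 1)) * t `^ (1 / (2 `^ (k - 3) - 1))
  else
    n `^ (3 - 1 / 2 `^ (k - 1))
    + n `^ (3 - k / (2 `^ k - 1)) * t `^ (1 / (2 `^ k - 1)).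

(* Main.v *)
Require Import Defs.
From mathcomp Require Import all_boot all_order all_algebra.
From mathcomp Require Import reals exp.
From mathcomp Require boolp.
From mathcomp Require Import zify ring lra.
Import Order.TTheory GRing.Theory Num.Theory.

Set Implicit Arguments.
Unset Strict Implicit.
Unset Printing Implicit Defensive.

(** Let x_1, ..., x_m be the deleted vertices of H, in order; m is k, or k - 3 if H
    has a triangle.  The search keeps three classes of vertices of G, one per color,
    initially all of G.  At depth i it samples vertices v from the class of the
    color of x_i, as candidate images of x_i, and recurses with the class of the
    (single) color of the remaining neighbors of x_i restricted to N(v).  Vertices
    of that class without sampled neighbor have low degree into the sampled class,
    in expectation, and are searched exhaustively.  Every triangle is found this way
    unless it survives to depth m in some branch, and then the sampled vertices,
    together with the triangle, form a copy of H.  With X^(2^i) samples at depth i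
    the expected time is O(n^3 / X), and a fixed triangle survives with probability
    at most t X^(2^m - 1) / n^m.  The bounds X^(2^(m-1)) <= n and
    4 t X^(2^m - 1) <= n^m determine the two terms of the running time.  An attempt
    is cut off after a constant multiple of its expected time, and log n attempts
    bring the error probability below 1/n. *)

(** * Error credits and deterministic running time *)

(** Both ways in which an attempt can fail are paid from one account. The threshold [theta] is the
    number of ticks allowed: each tick claims one unit of credit, so a run that is out of time holds
    at least [theta], and a leaf at which the triangle survives is assigned [theta] outright.
    Markov's inequality for the expected time and for survival thus becomes a single bookkeeping of
    credits, without a probability space. The required time bound must hold on every run; it is
    proved separately, by charging instructions to ticks, and this is also what lets a failed
    attempt be followed by the next one.

    A sampled vertex is removed from the other classes, since otherwise the surviving sequences need
    not be injective maps and could not be counted by [t]. The price is that a sample containing the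
    [c1]- or [c3]-vertex of a triangle may lose that triangle; hence the three disjoint samples.

    An attempt starts with credit at most half its threshold: a quarter for time, a quarter for
    survival. This is where [56 = 4 * 14] and the factor 4 in [4 * t] come from. *)

Section Logic.
Variables (R : realType) (B : nat) (V : finType) (e : rel V).
Implicit Types (s : state V) (K : seq cmd) (x : seq cmd * state V).

(* A run holds an amount [q] of credit, which a random choice may redistribute
   over its outcomes without increasing the average.  A run whose credit reaches
   [theta] counts as failed and carries no further obligation, so failure has
   probability at most (initial credit) / [theta]. *)
Inductive wp (theta : R) (Q : state V -> R -> Prop) :
    seq cmd * state V -> R -> Prop :=
| wp_abort x q : (theta <= q)%R -> wp theta Q x q
| wp_halt s q : Q s q -> wp theta Q ([::], s) q
| wp_step c K s (g : nat -> R) q :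
    (forall r, r < arity B e c s -> wp theta Q (outcome B e c K s r) (g r)) ->
    (\sum_(r < arity B e c s) g r <= q * (arity B e c s)%:R)%R ->
    wp theta Q (c :: K, s) q.

(** Worst-case termination with a postcondition, so that time bounds compose and an aborted attempt
    still leaves a usable state. *)
Inductive halts_with (P : state V -> Prop) : nat -> seq cmd * state V -> Prop :=
| halts_with_nil T s : P s -> halts_with P T ([::], s)
| halts_with_step T c K s :
    cost V c <= T ->
    (forall r, r < arity B e c s ->
       halts_with P (T - cost V c) (outcome B e c K s r)) ->
    halts_with P T (c :: K, s).

Lemma arity_gt0 c s : 0 < arity B e c s.
Proof. by case: c => //= *; rewrite leq_max. Qed.

Lemma cost_gt0 c : 0 < cost V c.
Proof. by case: c. Qed.

Lemma halts_with_runs P T x : halts_with P T x -> runs_within B e T x.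
Proof.
by elim=> {T x} [T s _|T c K s leT _ IH]; constructor.
Qed.

Lemma halts_with_leq P T T' x : T <= T' -> halts_with P T x -> halts_with P T' x.
Proof.
move=> leTT' H; elim: H T' leTT' => {T x} [T s Ps|T c K s leT _ IH] T' leTT'.
  exact: halts_with_nil.
apply: halts_with_step; first exact: leq_trans leTT'.
by move=> r ltr; apply: IH => //; apply: leq_sub2r.
Qed.

Lemma runs_within_leq T T' x :
  T <= T' -> runs_within B e T x -> runs_within B e T' x.
Proof.
move=> leTT' H; elim: H T' leTT' => {T x} [T s|T c K s leT _ IH] T' leTT'.
  exact: runs_halted.
apply: runs_step; first exact: leq_trans leTT'.
by move=> r ltr; apply: IH => //; apply: leq_sub2r.
Qed.

Lemma prob_answer_ge0 b m x : (0 <= prob_answer R B e b m x)%R.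
Proof.
elim: m x => [|m IH] [[|c K] s] //=; try exact: ler0n.
by apply: divr_ge0; [apply: sumr_ge0 => r _|exact: ler0n].
Qed.

(** Markov's inequality by induction on the run: where a branch aborts, [q >= 1] makes the bound
    void, and at a random choice credit and probability are averaged over the same outcomes. *)
Lemma wp_prob_answer b (Q : state V -> R -> Prop) T x q :
  (forall s q', Q s q' -> (0 <= q')%R /\ answer s = b) ->
  wp 1 Q x q -> runs_within B e T x -> (1 - q <= prob_answer R B e b T x)%R.
Proof.
move=> QP H; elim: H T => {x q} [x q le1q|s q Qsq|c K s g q _ IH leq] T HT.
- by apply: le_trans (prob_answer_ge0 _ _ _); lra.
- have [q0 ansb] := QP _ _ Qsq.
  by case: T {HT} => [|T] /=; rewrite ansb eqxx /=; lra.
- inversion_clear HT as [|? ? ? ? costT runs].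
  case: T costT runs => [|T] costT runs; first by have := cost_gt0 c; lia.
  rewrite /= ler_pdivlMr ?ltr0n ?arity_gt0 // mulrBl mul1r.
  apply: (@le_trans _ _ (\sum_(r < arity B e c s) (1 - g r))%R).
    by rewrite sumrB sumr_const card_ord; lra.
  apply: ler_sum => r _; apply: IH => //.
  by apply: runs_within_leq (runs _ _) => //; have := cost_gt0 c; lia.
Qed.

Lemma wp_mono theta (Q Q' : state V -> R -> Prop) x q :
  (forall s p, Q s p -> Q' s p) -> wp theta Q x q -> wp theta Q' x q.
Proof.
move=> QQ' H; elim: H => {x q} [x q le1q|s q Qsq|c K s g q _ IH leq].
- exact: wp_abort.
- by apply: wp_halt; apply: QQ'.
- exact: (wp_step (g := g)).
Qed.

Lemma wp_scale theta (Q : state V -> R -> Prop) z x q :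
  (0 < z)%R -> wp theta Q x q ->
  wp (theta * z)%R (fun s p => Q s (p / z)%R) x (q * z)%R.
Proof.
move=> z0; elim=> {x q} [x q le1q|s q Qsq|c K s g q _ IH leq].
- by apply: wp_abort; rewrite ler_pM2r.
- by apply: wp_halt; rewrite mulfK ?gt_eqF.
- apply: (wp_step (g := fun r => g r * z)%R) => //.
  by rewrite -mulr_suml mulrAC ler_pM2r.
Qed.

Lemma outcome_cat c K K' s r :
  outcome B e c (K ++ K') s r =
  ((outcome B e c K s r).1 ++ K', (outcome B e c K s r).2).
Proof. by case: c => //= *; case: ifP. Qed.

Lemma wp_cat theta Q K K' s q :
  wp theta (fun s' q' => wp theta Q (K', s') q') (K, s) q ->
  wp theta Q (K ++ K', s) q.
Proof.
move Ex: (K, s) => x H.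
elim: H K s Ex => {x q} [x q le1q|s q Qsq|c K s g q _ IH leq] K0 s0.
- by move=> _; apply: wp_abort.
- by case=> -> ->.
- case=> -> ->; apply: (wp_step (g := g)) => // r ltr.
  by rewrite outcome_cat; apply: IH => //; case: (outcome _ _ _ _ _).
Qed.

Lemma wp_cons theta Q c K s q :
  wp theta (fun s' q' => wp theta Q (K, s') q') ([:: c], s) q ->
  wp theta Q (c :: K, s) q.
Proof. exact: (@wp_cat theta Q [:: c]). Qed.

Lemma wp_det theta Q c K s q :
  arity B e c s = 1 ->
  wp theta Q (outcome B e c K s 0) q -> wp theta Q (c :: K, s) q.
Proof.
move=> ar1 H; apply: (wp_step (g := fun=> q)).
  by rewrite ar1 => -[].
by rewrite sumr_const card_ord mulr_natr.
Qed.

Lemma halts_with_wp theta (P : state V -> Prop) (Q : state V -> R -> Prop) T x q :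
  halts_with P T x -> (forall s, P s -> Q s q) -> wp theta Q x q.
Proof.
move=> H PQ; elim: H => {T x} [T s Ps|T c K s _ _ IH].
  by apply: wp_halt; apply: PQ.
apply: (wp_step (g := fun=> q)) => //.
by rewrite sumr_const card_ord mulr_natr.
Qed.

(* Trades the abort rule for actual termination. *)
Lemma wp_halts_with theta theta' (P : state V -> Prop)
    (Q Q' : state V -> R -> Prop) T x q :
  halts_with P T x -> wp theta Q x q ->
  (forall s q', P s -> Q s q' -> Q' s q') ->
  (forall s q', P s -> (theta <= q')%R -> Q' s q') ->
  wp theta' Q' x q.
Proof.
move=> HT H HQ Ht; elim: H T HT => {x q} [x q leq|s q Qsq|c K s g q _ IH leq] T HT.
- by apply: halts_with_wp HT _ => s Ps; apply: Ht.
- by inversion_clear HT as [? ? Ps|]; apply: wp_halt; apply: HQ.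
- inversion_clear HT as [|? ? ? ? costT runs].
  by apply: (wp_step (g := g)) => // r ltr; apply: IH (runs _ ltr).
Qed.

(** Straight-line execution with its exact cost, usable both for time ([det_halts_with]) and for
    credit ([det_wp]). *)
Inductive det : nat -> seq cmd * state V -> seq cmd * state V -> Prop :=
| det_refl x : det 0 x x
| det_step c K s T x : arity B e c s = 1 -> det T (outcome B e c K s 0) x ->
    det (cost V c + T) (c :: K, s) x.

Lemma det_next c K s T T' x :
  arity B e c s = 1 -> T' = cost V c + T -> det T (outcome B e c K s 0) x ->
  det T' (c :: K, s) x.
Proof. by move=> ar -> ?; apply: det_step. Qed.

Lemma det_wp theta Q T x x' q : det T x x' -> wp theta Q x' q -> wp theta Q x q.
Proof. by elim=> // c K s T0 x0 ar _ IH /IH; apply: wp_det. Qed.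

Lemma det_halts_with P T T' x x' :
  det T x x' -> halts_with P T' x' -> halts_with P (T + T') x.
Proof.
elim=> // c K s T0 x0 ar _ IH /IH H.
apply: halts_with_step; first lia.
rewrite ar => -[|] // _; rewrite -addnA addKn; exact: H.
Qed.

Lemma det_trans T T' x y z : det T x y -> det T' y z -> det (T + T') x z.
Proof.
by elim=> // c K s T0 x0 ar _ IH /IH H; rewrite -addnA; apply: det_step.
Qed.

End Logic.

(** * The algorithm *)

Fixpoint epow (a : nexp) (n : nat) : nexp :=
  if n is n'.+1 then emul a (epow a n') else econst 1.

Definition block : seq cmd -> cmd := foldr cseq cskip.

(* Numeric registers: 0 = answer, 1 = t, 2 = n, 3 = steps made, 4 = allowed
   number of steps, 5 = scratch, 6 = sampling parameter X, 7 = outer loop. *)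
Definition tick : cmd := cnum 3 (eadd (ereg 3) (econst 1)).

Definition bounded_while (g : bexp) (c : cmd) : cmd :=
  cwhile (band g (bnot (ble (ereg 4) (ereg 3)))) (cseq tick c).

Definition foreach (v r : nat) (c : cmd) : cmd :=
  cseq (cpick v (sreg r))
    (bounded_while (bmem v r)
      (cseq (cset r (sdiff (sreg r) (ssingle v))) (cseq c (cpick v (sreg r))))).

(* At recursion depth [i], set registers 10i + 0..2 hold the three vertex
   classes, 10i + 3..5 the samples, and 10i + 6..8 are loop variables. *)
Definition put_sample (i j : nat) : cmd :=
  let s := epow (ereg 6) (2 ^ i) in
  cif (band (ble (emul (econst j) s) (ereg 5))
            (bnot (ble (emul (econst j.+1) s) (ereg 5))))
    (cset (10 * i + 3 + j) (sunion (ssingle (10 * i)) (sreg (10 * i + 3 + j))))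
    cskip.

Definition sample (i c1 : nat) : cmd :=
  block [:: cset (10 * i + 3) sempty; cset (10 * i + 4) sempty;
            cset (10 * i + 5) sempty; cset (10 * i + 6) (sreg (10 * i + c1));
            foreach (10 * i) (10 * i + 6)
              (block [:: crand 5 (emul (econst 3) (ereg 2));
                         put_sample i 0; put_sample i 1; put_sample i 2])].

Definition restrict (i c c2 : nat) : cmd :=
  cset (10 * i + 10 + c)
    (if c == c2 then sinter (sreg (10 * i + c)) (snbhd (10 * i))
     else sdiff (sreg (10 * i + c)) (ssingle (10 * i))).

Definition check (i c3 : nat) : cmd :=
  cseq (ccard 5 (sinter (sinter (snbhd (10 * i + 1)) (snbhd (10 * i + 2)))
                        (sreg (10 * i + c3))))
    (cif (band (bedge (10 * i + 1) (10 * i + 2)) (ble (econst 1) (ereg 5)))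
      (cnum 0 (econst 1)) cskip).

Definition brute (i c1 c3 : nat) : cmd :=
  foreach (10 * i + 1) (10 * i + 7)
    (cseq (cset (10 * i + 8) (sinter (snbhd (10 * i + 1)) (sreg (10 * i + c1))))
          (foreach (10 * i + 2) (10 * i + 8) (check i c3))).

(* The recursion treats the triangles inside [S c1 \ v], [S c2 :&: N(v)],
   [S c3 \ v] for the sampled [v]; the triangles whose [c2]-vertex has no sampled
   neighbor are searched for directly, which is cheap as such a vertex tends to
   have few neighbors in [S c1]. *)
Definition pass (child : cmd) (i c1 c2 c3 j : nat) : cmd :=
  block [:: cset (10 * i + 7) (sreg (10 * i + c2));
            foreach (10 * i) (10 * i + 3 + j)
              (block [:: cset (10 * i + 7) (sdiff (sreg (10 * i + 7)) (snbhd (10 * i)));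
                         restrict i 0 c2; restrict i 1 c2; restrict i 2 c2; child]);
            brute i c1 c3].

Definition third (c1 c2 : nat) : nat := 3 - c1 - c2.

(* A triangle is missed by a pass only if its [c1]- or [c3]-vertex was sampled;
   with three disjoint samples, some pass avoids both.  The leaves of the
   recursion are skipped: a triangle reaching one extends to a copy of H. *)
Fixpoint node (i : nat) (l : seq (nat * nat)) : cmd :=
  if l is (c1, c2) :: l' then
    let child := node i.+1 l' in
    let c3 := third c1 c2 in
    block [:: sample i c1; pass child i c1 c2 c3 0; pass child i c1 c2 c3 1;
              pass child i c1 c2 c3 2]
  else cskip.

(* A run between two ticks executes each instruction of the program text only
   boundedly often, which bounds its cost by the number of ticks. *)
Fixpoint weight (c : cmd) : nat :=
  match c with
  | cseq c1 c2 | cif _ c1 c2 => (weight c1 + weight c2).+1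
  | cwhile _ c1 => (weight c1).+1
  | _ => 1
  end.

(** * Worst-case time of a node, and soundness of a positive answer *)

Section Tame.
Variables (B : nat) (V : finType) (e : rel V) (s0 : state V).
Hypotheses (e_sym : symmetric e) (B_gt0 : 0 < B).
Implicit Types (s : state V) (K : seq cmd).

(** The first half makes the error one-sided. Registers 0, 3 and 5 are the only numeric ones that a
    node writes. *)
Definition safe s : Prop :=
  (num s 0 != 0 -> has_triangle e) /\
  forall j, j \notin [:: 0; 3; 5] -> num s j = num s0 j.

Definition steps_left s : nat := num s 4 - num s 3.

Definition tame (c : cmd) : Prop := forall P K s T,
  safe s ->
  (forall s', safe s' -> steps_left s' <= steps_left s ->
     halts_with B e P (T + #|V|.+1 * (weight c * steps_left s')) (K, s')) ->
  halts_with B e P (T + #|V|.+1 * (weight c * (steps_left s).+1)) (c :: K, s).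

Lemma tame_seq c1 c2 : tame c1 -> tame c2 -> tame (cseq c1 c2).
Proof.
rewrite /tame => tame1 tame2 P K s T safe_s HK.
move: (#|V|.+1) (ltn0Sn #|V|) tame1 tame2 HK => U U0 tame1 tame2 HK.
set p := steps_left s.
have H0 : 0 < U * ((weight c2).+1 * p.+1) by rewrite !muln_gt0 U0.
apply: halts_with_step => [/=|[|//] _ /=]; first by lia.
apply: (@halts_with_leq _ _ _ _ (T + U * ((weight c2).+1 * p.+1) - 1 +
   U * (weight c1 * p.+1))); first by lia.
apply: tame1 => // s1 safe1 le1.
set p1 := steps_left s1 in le1 *.
have H1 : U * ((weight c2).+1 * p1) <= U * ((weight c2).+1 * p) by rewrite !leq_mul.
apply: (@halts_with_leq _ _ _ _ (T + U * ((weight c1).+1 * p1) +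
   U * (weight c2 * p1.+1))); first by rewrite -/p1; lia.
apply: tame2 => // s2 safe2 le2.
apply: halts_with_leq (HK s2 safe2 _); last exact: leq_trans le2 le1.
rewrite -/p1 in le2; set p2 := steps_left s2 in le2 *.
have H2 : U * ((weight c1).+1 * p2) <= U * ((weight c1).+1 * p1) by rewrite !leq_mul.
by rewrite /=; lia.
Qed.

Lemma tame_if b c1 c2 : tame c1 -> tame c2 -> tame (cif b c1 c2).
Proof.
rewrite /tame => tame1 tame2 P K s T safe_s HK.
move: (#|V|.+1) (ltn0Sn #|V|) tame1 tame2 HK => U U0 tame1 tame2 HK.
set p := steps_left s.
have H0 w : 0 < U * w.+1 by rewrite muln_gt0 U0.
have H1 := H0 (weight c1); have H2 := H0 (weight c2).
have Hp w s' : steps_left s' <= p -> U * (w.+1 * steps_left s') <= U * (w.+1 * p).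
  by move=> le'; rewrite !leq_mul.
apply: halts_with_step => [/=|[|//] _ /=]; first by lia.
case: ifP => _.
- apply: (@halts_with_leq _ _ _ _ (T + U * ((weight c2).+1 * p) +
    U * (weight c1 * p.+1))); first by lia.
  apply: tame1 => // s1 safe1 le1.
  apply: halts_with_leq (HK s1 safe1 le1).
  by have := Hp (weight c2) s1 le1; rewrite /=; lia.
- apply: (@halts_with_leq _ _ _ _ (T + U * ((weight c1).+1 * p) +
    U * (weight c2 * p.+1))); first by lia.
  apply: tame2 => // s1 safe1 le1.
  apply: halts_with_leq (HK s1 safe1 le1).
  by have := Hp (weight c1) s1 le1; rewrite /=; lia.
Qed.

Lemma tame_basic c :
  weight c = 1 ->
  (forall s r, safe s -> r < arity B e c s -> exists s',
     [/\ forall K, outcome B e c K s r = (K, s'), safe s'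
       & steps_left s' <= steps_left s]) ->
  tame c.
Proof.
move=> w1 out P K s T safe_s; rewrite w1 => HK.
have cU : cost V c <= #|V|.+1 by case: (c).
apply: halts_with_step => [|r ltr]; first by rewrite mul1n mulnS; lia.
have [s' [-> safe' le']] := out s r safe_s ltr.
apply: halts_with_leq (HK s' safe' le').
have : #|V|.+1 * steps_left s' <= #|V|.+1 * steps_left s by rewrite leq_mul.
by rewrite !mul1n mulnS; lia.
Qed.

Lemma tame_skip : tame cskip.
Proof. by apply: tame_basic => // s r safe_s _; exists s. Qed.

Lemma tame_pick i a : tame (cpick i a).
Proof. by apply: tame_basic => // s r safe_s _; eexists; split=> // K. Qed.

Lemma tame_set i a : tame (cset i a).
Proof. by apply: tame_basic => // s r safe_s _; eexists; split=> // K. Qed.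

Lemma safe_scratch s a : safe s -> safe (set_num s 5 a).
Proof.
case=> found reg; split=> // j nj; rewrite /= /upd -reg //.
by case: eqP nj => // ->.
Qed.

Lemma tame_rand a : tame (crand 5 a).
Proof.
apply: tame_basic => // s r safe_s _; exists (set_num s 5 r).
by split=> //; apply: safe_scratch.
Qed.

Lemma tame_block cs : (forall c, List.In c cs -> tame c) -> tame (block cs).
Proof.
elim: cs => [|c cs IH] H; first exact: tame_skip.
by apply: tame_seq; [apply: H; left|apply: IH => c' ?; apply: H; right].
Qed.

(** Passing the guard forces the counter below [B], so the increment cannot saturate. *)
Lemma tick_spec s :
  ~~ (neval B s (ereg 4) <= neval B s (ereg 3)) ->
  [/\ num s 3 < num s 4,
      forall K, outcome B e tick K s 0 = (K, set_num s 3 (num s 3).+1)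
    & steps_left (set_num s 3 (num s 3).+1) < steps_left s].
Proof.
rewrite /= /steps_left /= /upd /= -ltnNge => lt34.
have ltB : num s 3 < B by lia.
split; [lia| |lia].
by move=> K; congr (K, set_num _ _ _); lia.
Qed.

Lemma safe_tick s a : safe s -> safe (set_num s 3 a).
Proof.
case=> found reg; split=> // j nj; rewrite /= /upd -reg //.
by case: eqP nj => // ->.
Qed.

(** Every iteration ticks, so induction on the ticks left applies. The weight exceeds that of the
    body by 3: guard, sequencing and tick. *)
Lemma tame_while g c : tame c -> tame (bounded_while g c).
Proof.
rewrite /tame => tame_c P K s T safe_s HK.
move: (#|V|.+1) (ltn0Sn #|V|) tame_c HK => U U0 tame_c HK.
set w := weight _ in HK *.
have wE : w = (weight c).+3 by [].
have [n] := ubnP (steps_left s); elim: n s safe_s HK => // n IH s safe_s HK ltn.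
set p := steps_left s in HK ltn *.
have H0 : 0 < U * (p.+1) by rewrite muln_gt0 U0.
have wpE : U * (w * p.+1) = U * (weight c * p) + U * weight c + 3 * (U * p.+1).
  by rewrite wE; lia.
apply: halts_with_step => [/=|[|//] _ /=]; first by lia.
case: ifP => [/andP[_ gd]|_]; last first.
  by apply: halts_with_leq (HK s safe_s (leqnn _)); rewrite -/p; lia.
have [_ Eo ltp] := tick_spec gd; rewrite -/p in ltp.
set s1 := set_num s 3 _ in Eo ltp; set p1 := steps_left s1 in ltp.
apply: halts_with_step => [/=|[|//] _ /=]; first by lia.
apply: halts_with_step => [/=|[|//] _]; first by lia.
rewrite Eo.
have H1 : U * (weight c * p1.+1) <= U * (weight c * p) by rewrite !leq_mul.
apply: (@halts_with_leq _ _ _ _ (T + U * (w * p.+1) - 3 - U * (weight c * p) +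
  U * (weight c * p1.+1))); first by rewrite /=; lia.
have safe1 : safe s1 by apply: safe_tick.
apply: tame_c => // s2 safe2 le2; rewrite -/p1 in le2.
set p2 := steps_left s2 in le2 *.
have H2 : U * p2.+1 <= U * p by rewrite leq_mul //; lia.
apply: (@halts_with_leq _ _ _ _ (T + U * (w * p2.+1))).
  by rewrite wpE wE; lia.
apply: IH => //; last by rewrite -/p2; lia.
by move=> s' safe' le'; apply: HK => //; rewrite -/p2 in le'; lia.
Qed.

Lemma tame_foreach v r c : tame c -> tame (foreach v r c).
Proof.
move=> tame_c; apply: tame_seq; first exact: tame_pick.
apply/tame_while/tame_seq; first exact: tame_set.
by apply: tame_seq => //; apply: tame_pick.
Qed.

Lemma tame_put_sample i j : tame (put_sample i j).
Proof. by apply: tame_if; [apply: tame_set|apply: tame_skip]. Qed.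

Lemma tame_sample i c1 : tame (sample i c1).
Proof.
apply: tame_block => _ [<-|[<-|[<-|[<-|[<-|[]]]]]]; do 1? exact: tame_set.
apply/tame_foreach/tame_block => _ [<-|[<-|[<-|[<-|[]]]]].
- exact: tame_rand.
1-3: exact: tame_put_sample.
Qed.

(** The one place where register 0 is set. The guard has just exhibited an edge with a common
    neighbor, that is, a triangle. *)
Lemma tame_check i c3 : tame (check i c3).
Proof.
move=> P K s T safe_s HK.
set p := steps_left s; have U0 := ltn0Sn #|V|.
set U := #|V|.+1 in U0 HK *.
have HU : U <= U * p.+1 by rewrite leq_pmulr.
have HK' s' : safe s' -> steps_left s' = p ->
    halts_with B e P (T + U * (5 * p.+1) - 1 - U - 1 - 1) (K, s').
  move=> safe' Ep; apply: halts_with_leq (HK s' safe' _); rewrite ?Ep //=.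
  by lia.
apply: halts_with_step => [/=|[|//] _]; first by lia.
apply: halts_with_step => [|[|//] _]; first by rewrite -[cost _ _]/U /=; lia.
rewrite -[cost _ (ccard _ _)]/U.
apply: halts_with_step => [/=|[|//] _ /=]; first by lia.
set s1 := set_num s 5 _.
have safe1 : safe s1 by apply: safe_scratch.
have le1 : steps_left s1 <= p by [].
case: ifP => [/andP[edge12 card_gt0]|_].
  apply: halts_with_step => [/=|[|//] _ /=]; first by lia.
  apply: HK' => //; split=> [_|j nj]; last first.
    case: safe1 => _ <- //; rewrite /= /upd.
    by case: eqP nj => // ->.
  move: edge12 card_gt0; rewrite /s1 /=.
  case: (vtx s _) => // b; case: (vtx s _) => // a eba.
  rewrite /upd /= => card_gt0.
  have /card_gt0P[c]: 0 < #|[set w | e b w] :&: [set w | e a w] :&: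
      vset s (10 * i + c3)|.
    by move: (#|pred_of_set _|) card_gt0 => z; lia.
  rewrite !inE => /andP[/andP[ebc eac] _].
  apply/existsP; exists b; apply/existsP; exists a; apply/existsP; exists c.
  by rewrite eba eac e_sym ebc.
apply: halts_with_step => [/=|[|//] _ /=]; first by lia.
exact: HK'.
Qed.

Lemma tame_pass child i c1 c2 c3 j : tame child -> tame (pass child i c1 c2 c3 j).
Proof.
move=> tame_child; apply: tame_block => _ [<-|[<-|[<-|[]]]].
- exact: tame_set.
- apply/tame_foreach/tame_block => _ [<-|[<-|[<-|[<-|[<-|[]]]]]] //.
  1-4: by rewrite ?/restrict; apply: tame_set.
- apply: tame_foreach; apply: tame_seq; first exact: tame_set.
  exact/tame_foreach/tame_check.
Qed.

Lemma tame_node i l : tame (node i l).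
Proof.
elim: l i => [|[c1 c2] l IH] i; first exact: tame_skip.
apply: tame_block => _ [<-|[<-|[<-|[<-|[]]]]]; first exact: tame_sample.
all: exact: tame_pass.
Qed.

End Tame.

Ltac reg_lia :=
  repeat match goal with
  | H : ?P |- _ => lazymatch P with is_true (_ < 3) => revert H | _ => clear H end
  end; rewrite /=; lia.

(** Lets overflow be checked once, on the exact value of a product, instead of at each intermediate
    saturation. *)
Lemma minn_cap B x y : minn B (minn B x * minn B y) = minn B (x * y).
Proof.
case: B => [|B]; first by rewrite !min0n.
have [ltx|lex] := ltnP B.+1 x; have [lty|ley] := ltnP B.+1 y => //.
- by rewrite !(minn_idPl _) //; nia.
- case: y ley => [|y] ley; first by rewrite !muln0.
  by rewrite !(minn_idPl _) //; nia.
- case: x lex => [|x] lex; first by rewrite !mul0n.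
  by rewrite !(minn_idPl _) //; nia.
Qed.

(** * Credit analysis of the recursion, for a fixed triangle *)

Section Correct.
Variables (R : realType) (B : nat) (V : finType) (e : rel V).
Variables (bud X : nat).
Hypothesis e_sym : symmetric e.
Hypotheses (bud_leq : bud <= B) (B_gt0 : 0 < B).
Implicit Types (s : state V) (K : seq cmd) (Q : state V -> R -> Prop).
Implicit Types (A D T : {set V}) (S : nat -> {set V}).

Let theta : R := bud%:R.
Let cnt s : R := (num s 3)%:R.
Notation wp := (wp B e theta).

Definition nbhd (v : V) : {set V} := [set w | e v w].

Definition agree (keep : pred nat) (b : nat) s s' : Prop :=
  [/\ forall j, keep j -> vset s' j = vset s j,
      forall j, j < b -> vtx s' j = vtx s j,
      forall j, j \notin [:: 0; 3; 5] -> num s' j = num s j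
    & num s 0 != 0 -> num s' 0 != 0].

Lemma agree_refl k b s : agree k b s s.
Proof. by split. Qed.

Lemma agree_trans k k' b b' s s' s'' :
  agree k b s s' -> agree k' b' s' s'' -> subpred k k' -> b <= b' ->
  agree k b s s''.
Proof.
case=> vs vv nn f [vs' vv' nn' f'] kk' bb'; split=> [j kj|j jb|j nj|/f/f'] //.
- by rewrite vs' ?vs ?kk'.
- by rewrite vv' ?vv //; apply: leq_trans bb'.
- by rewrite nn' ?nn.
Qed.

Lemma agree_vset k b s s' j A :
  ~~ k j -> agree k b s s' -> agree k b s (set_vset s' j A).
Proof.
move=> kj [vs vv nn f]; split=> //= i ki; rewrite /upd -vs //.
by case: eqP kj ki => // -> /negP.
Qed.

Lemma agree_vtx k b s s' j v :
  b <= j -> agree k b s s' -> agree k b s (set_vtx s' j v).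
Proof.
move=> bj [vs vv nn f]; split=> //= i ib; rewrite /upd -vv //.
by case: eqP ib => // ->; lia.
Qed.

Lemma agree_num k b s s' j a :
  j \in [:: 3; 5] -> agree k b s s' -> agree k b s (set_num s' j a).
Proof.
move=> j35 [vs vv nn f]; split=> //=.
  move=> i ni; rewrite /upd -nn //.
  by case: eqP ni => // ->; rewrite in_cons j35 orbT.
by move=> /f; rewrite /upd; case: (0 =P j) => // E0; rewrite -E0 in j35.
Qed.

Lemma agree_found k b s s' a :
  a != 0 -> agree k b s s' -> agree k b s (set_num s' 0 a).
Proof.
by move=> a0 [vs vv nn f]; split=> // -[|i] // ni; rewrite /= /upd /= -nn.
Qed.

(** The invariant is indexed by the set [T] not yet visited, so the random order of the picks needs
    no credit. As [cnt s <= q], a loop stopped by the tick limit holds at least [theta] and aborts;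
    the exit premise only sees an exhausted set. *)
Lemma wp_foreach v r c (I : {set V} -> state V -> R -> Prop) Q K s q :
  (forall T s q, I T s q -> num s 4 = bud /\ (cnt s <= q)%R) ->
  (forall T s q u, I T s q -> I T (set_vtx s v u) q) ->
  (forall T s q u, I T s q -> u \in T -> vtx s v = Some u -> vset s r = T ->
     wp (fun s' q' => vset s' r = T :\ u /\ I (T :\ u) s' q')
       ([:: c], set_vset (set_num s 3 (num s 3).+1) r (T :\ u)) q) ->
  (forall s q, I set0 s q -> wp Q (K, s) q) ->
  I (vset s r) s q -> wp Q (foreach v r c :: K, s) q.
Proof.
move=> Ibud Ivtx Istep Iexit Is.
apply: wp_det => //=; move ET: (vset s r) Is => T Is.
have [k] := ubnP #|T|; elim: k => // k IH in T s q ET Is * => ltk.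
apply: (wp_step (g := fun=> q)) => [u|]; last first.
  by rewrite sumr_const card_ord mulr_natr.
rewrite /= ET => ltu; set s1 := set_vtx s v _.
have Is1 : I T s1 q by apply: Ivtx.
have ET1 : vset s1 r = T by [].
have vE : vtx s1 v = onth (enum T) u by rewrite /= /upd eqxx.
move: Is1 ET1 vE; move: s1 => s1 Is1 ET1 vE {Is ET s}.
have [T0|[w wT]] := set_0Vmem T.
  apply: wp_det => //=; rewrite vE T0 enum_set0 onth0n /=; apply: Iexit.
  by rewrite -T0.
move: ltu; rewrite (maxn_idPr _); last by apply/card_gt0P; exists w.
rewrite cardE => ltu.
have {}vE : vtx s1 v = Some (nth w (enum T) u) by rewrite vE onthE (nth_map w).
set z := nth w (enum T) u in vE.
have zT : z \in T by rewrite -mem_enum mem_nth.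
have [bE cq] := Ibud _ _ _ Is1.
apply: wp_det => //=; rewrite vE ET1 zT /=; case: ifP => gd; last first.
  apply: wp_abort; apply: le_trans cq; rewrite ler_nat.
  move: gd => /negbFE; rewrite bE; lia.
have [_ Eo _] := tick_spec e B_gt0 gd.
apply: wp_det => //=; apply: wp_det => //; rewrite Eo.
do 3 (apply: wp_det => //=); rewrite ET1 /upd /= vE -/z.
apply: wp_cons.
apply: wp_mono (Istep _ _ _ _ Is1 zT vE ET1) => s2 p [ET2 Is2].
by apply: (IH _ _ _ ET2 Is2); move: ltk; rewrite (cardsD1 z T) zT.
Qed.

Lemma vset_set_neq s i j A : j != i -> vset (set_vset s i A) j = vset s j.
Proof. by rewrite /= /upd => /negPf->. Qed.

Lemma vset_set_eq s i A : vset (set_vset s i A) i = A.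
Proof. by rewrite /= /upd eqxx. Qed.

Lemma wp_check i c3 s q K Q b (v a c : V) :
  vtx s (10 * i + 1) = Some v -> vtx s (10 * i + 2) = Some a ->
  (forall s', agree predT b s s' -> cnt s' = cnt s ->
     (e v a -> e v c -> e a c -> c \in vset s (10 * i + c3) -> num s' 0 != 0) ->
     wp Q (K, s') q) ->
  wp Q (check i c3 :: K, s) q.
Proof.
move=> vE aE H; do 3 (apply: wp_det => //=).
rewrite vE aE; set s1 := set_num s 5 _.
have ag1 : agree predT b s s1 by apply: agree_num => //; apply: agree_refl.
case: ifP => [_|/negbT].
  apply: wp_det => //=; apply: H => //; first by apply: agree_found => //; lia.
  by move=> *; rewrite /= /upd /=; lia.
move=> nfound; apply: wp_det => //=; apply: H => // eva evc eac cS.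
case/negP: nfound; rewrite eva /upd /=.
have: 0 < #|[set w | e v w] :&: [set w | e a w] :&: vset s (10 * i + c3)|.
  by apply/card_gt0P; exists c; rewrite !inE evc eac.
by move: (#|pred_of_set _|) => z; lia.
Qed.

Section Triangle.
Variable tri : nat -> V.
Hypothesis tri_edge : forall c c', c < 3 -> c' < 3 -> c != c' -> e (tri c) (tri c').

Definition deg A v := #|nbhd v :&: A|.

(** One tick for each vertex of the searched set and one for each of its neighbors in class [c1].
    The credit [E] is reserved for the continuation; carrying it through every bound is what makes
    these specifications compose. *)
Lemma wp_brute i c1 c2 c3 s (q E : R) K Q :
  c1 < 3 -> c2 < 3 -> c3 < 3 -> c1 != c2 -> c2 != c3 -> c1 != c3 ->
  num s 4 = bud -> (0 <= E)%R ->
  (cnt s + E + \sum_(v in vset s (10 * i + 7))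
     (1 + (deg (vset s (10 * i + c1)) v)%:R) <= q)%R ->
  (forall s' (q' : R), agree (fun j => j < 10 * i + 7) (10 * i + 1) s s' ->
     (cnt s' + E <= q')%R ->
     (tri c2 \in vset s (10 * i + 7) -> tri c1 \in vset s (10 * i + c1) ->
      tri c3 \in vset s (10 * i + c3) -> num s' 0 != 0) ->
     wp Q (K, s') q') ->
  wp Q (brute i c1 c3 :: K, s) q.
Proof.
move=> lt1 lt2 lt3 n12 n23 n13 budE E0.
set A := vset s (10 * i + c1); set C := vset s (10 * i + c3).
set S0 := vset s (10 * i + 7) => leq HK.
pose I (T : {set V}) s' (q' : R) := [/\ agree (fun j => j < 10 * i + 7) (10 * i + 1) s s',
  (cnt s' + E + \sum_(v in T) (1 + (deg A v)%:R) <= q')%R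
  & tri c2 \in S0 :\: T -> tri c1 \in A -> tri c3 \in C -> num s' 0 != 0].
have sum_ge0 T : (0 <= \sum_(v in T) (1 + (deg A v)%:R) :> R)%R.
  by apply: sumr_ge0 => v _; rewrite addr_ge0.
apply: (wp_foreach (I := I)).
- move=> T s1 q1 [[_ _ ag _] le1 _]; rewrite ag // budE; split=> //.
  by have := sum_ge0 T; lra.
- by move=> T s1 q1 u [ag le1 f]; split=> //; apply: agree_vtx => //; reg_lia.
- move=> T s1 q1 v [ag le1 f] vT vE ET.
  set s2 := set_vset _ _ _.
  have ag2 : agree (fun j => j < 10 * i + 7) (10 * i + 1) s s2.
    by apply: agree_vset; [reg_lia|apply: agree_num].
  have le2 : (cnt s2 + E + \sum_(w in T :\ v) (1 + (deg A w)%:R) +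
      (deg A v)%:R <= q1)%R.
    have -> : cnt s2 = (cnt s1 + 1)%R by rewrite /cnt /= /upd /= -natr1.
    by move: le1; rewrite (big_setD1 v vT) /=; lra.
  have f2 : num s2 0 = num s1 0 by [].
  have v2 : vtx s2 (10 * i + 1) = Some v by [].
  have A2 : vset s2 (10 * i + c1) = A by case: ag2 => -> //; reg_lia.
  have C2 : vset s2 (10 * i + c3) = C by case: ag2 => -> //; reg_lia.
  have T2 : vset s2 (10 * i + 7) = T :\ v by rewrite /= /upd eqxx.
  move: s2 ag2 le2 f2 v2 A2 C2 T2 => s2 ag2 le2 f2 v2 A2 C2 T2.
  do 2 (apply: wp_det => //=); rewrite v2 A2 -/(nbhd v).
  set s3 := set_vset _ _ _.
  pose J (U : {set V}) s' (q' : R) := [/\ agree (fun j => j < 10 * i + 8) (10 * i + 2) s3 s',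
    (cnt s' + E + \sum_(w in T :\ v) (1 + (deg A w)%:R) + #|U|%:R <= q')%R
    & v = tri c2 -> tri c1 \in A :\: U -> tri c3 \in C -> num s' 0 != 0].
  apply: (wp_foreach (I := J)).
  + move=> U s4 q4 [[_ _ ag4 _] le4 _]; rewrite ag4 //=; split.
      by case: ag2 => _ _ nn _; rewrite nn ?budE.
    by have := sum_ge0 (T :\ v); have := ler0n R #|U|; lra.
  + by move=> U s4 q4 u [ag4 le4 f4]; split=> //; apply: agree_vtx => //; reg_lia.
  + move=> U s4 q4 a [ag4 le4 f4] aU aE EU.
    set s5 := set_vset _ _ _.
    have ag5 : agree (fun j => j < 10 * i + 8) (10 * i + 2) s3 s5.
      by apply: agree_vset; [reg_lia|apply: agree_num].
    have C5 : vset s5 (10 * i + c3) = C.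
      by case: ag5 => ->; rewrite ?vset_set_neq ?C2 //; reg_lia.
    apply: (@wp_check _ _ _ _ _ _ (10 * i + 2) v a (tri c3)).
    * by case: ag5 => _ -> //; reg_lia.
    * exact: aE.
    move=> s6 ag6 cnt6 f6; apply: wp_halt.
    have ag36 : agree (fun j => j < 10 * i + 8) (10 * i + 2) s3 s6.
      exact: agree_trans ag5 ag6 _ _.
    split; first by case: ag6 => ->; rewrite //= /upd eqxx.
    split=> //.
      have -> : cnt s6 = (cnt s4 + 1)%R by rewrite cnt6 /cnt /= /upd /= -natr1.
      have cU : (#|U|%:R = #|U :\ a|%:R + 1 :> R)%R by rewrite (cardsD1 a U) aU natrD addrC.
      by rewrite cU in le4; clear - le4; lra.
    move=> vE2 inA inC; have [E1|ne1] := eqVneq (tri c1) a.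
      by apply: f6; rewrite ?C5 // ?vE2 -?E1; apply: tri_edge; rewrite // eq_sym.
    case: ag6 => _ _ _; apply; apply: f4 => //.
    by move: inA; rewrite !inE ne1.
  + move=> s4 q4 [ag4 le4 f4]; apply: wp_halt; split.
      by case: ag4 => ->; rewrite ?vset_set_neq ?T2 //; reg_lia.
    split.
    * apply: (agree_trans (s' := s3)); first by apply: agree_vset; [reg_lia|exact: ag2].
        exact: ag4.
      by move=> j /=; reg_lia.
      by reg_lia.
    * by move: le4; rewrite cards0; lra.
    * move=> in2 in1 in3; have [E2|ne2] := eqVneq (tri c2) v.
        by apply: f4; rewrite // setD0.
      case: ag4 => _ _ _; apply; rewrite /= f2; apply: f => //.
      by move: in2; rewrite !inE ne2.
  + split=> [||E2]; first exact: agree_refl.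
      rewrite /= /upd eqxx; move: le2; rewrite /deg /cnt /=; lra.
    rewrite vset_set_eq !inE => /andP[/negP nin inA]; case: nin.
    by rewrite inA E2 tri_edge // eq_sym.
- move=> s1 q1 [ag1 le1 f1]; apply: HK => //.
    by move: le1; rewrite big_set0; lra.
  by rewrite setD0 in f1.
- by split=> //; rewrite setDv inE.
Qed.

(** Deleting [v] keeps the sampled sequence injective; in class [c2] the intersection with [nbhd v]
    already does this in a loopless graph. *)
Definition restricted S c2 v : nat -> {set V} :=
  fun c => if c == c2 then S c :&: nbhd v else S c :\ v.

Definition alive S : bool := [&& tri 0 \in S 0, tri 1 \in S 1 & tri 2 \in S 2].

(* Number of sequences of sampled vertices along which the triangle [tri] stays
   alive until a leaf of the recursion. *)
Fixpoint leaves (l : seq (nat * nat)) S : nat :=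
  if l is (c1, c2) :: l' then \sum_(v in S c1) leaves l' (restricted S c2 v)
  else alive S.

Let n : R := #|V|%:R.

(* Each vertex is in some sample at depth [i] with probability [X ^ 2 ^ i / n], so
   [branching] is the probability that a given sequence is sampled. *)
Fixpoint branching (i : nat) (l : seq (nat * nat)) : R :=
  if l is _ :: l' then ((X ^ 2 ^ i)%:R / n * branching i.+1 l')%R else 1%R.

(* Bound on the expected number of ticks of [node i l]. *)
Fixpoint ecost (i : nat) (l : seq (nat * nat)) : R :=
  if l is _ :: l' then
    (n + (X ^ 2 ^ i)%:R * (1 + ecost i.+1 l')
     + 3 * (n + 3 * n ^+ 2 / (maxn 1 (X ^ 2 ^ i))%:R))%R
  else 0%R.

Definition ctx s : Prop := [/\ num s 2 = #|V|, num s 4 = bud & num s 6 = X].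

Lemma ctx_agree k b s s' : agree k b s s' -> ctx s -> ctx s'.
Proof. by case=> _ _ ag _ [? ? ?]; split; rewrite ag. Qed.

Lemma branching_ge0 i l : (0 <= branching i l)%R.
Proof. by elim: l i => [|_ l IH] i //=; rewrite mulr_ge0 // divr_ge0 // /n ler0n. Qed.

Lemma ecost_ge0 i l : (0 <= ecost i l)%R.
Proof.
elim: l i => [|_ l IH] i //=.
have n0 : (0 <= n)%R by rewrite /n ler0n.
have H1 : (0 <= (X ^ 2 ^ i)%:R * (1 + ecost i.+1 l))%R.
  by rewrite mulr_ge0 // addr_ge0.
have H2 : (0 <= 3 * n ^+ 2 / (maxn 1 (X ^ 2 ^ i))%:R)%R.
  by rewrite divr_ge0 // mulr_ge0 // exprn_ge0.
lra.
Qed.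

(** The charge is the expected time plus [theta] times the expected number of leaves that the
    triangle reaches alive. Such a leaf aborts, so any run that gets past the node with the triangle
    initially alive has found it. *)
Definition node_spec (i : nat) (l : seq (nat * nat)) : Prop :=
  forall s S (q E : R) K Q,
  ctx s -> (forall c, c < 3 -> vset s (10 * i + c) = S c) -> (0 <= E)%R ->
  (cnt s + E + ecost i l + theta * branching i l * (leaves l S)%:R <= q)%R ->
  (forall s' (q' : R), agree (fun j => j < 10 * i + 3) (10 * i) s s' ->
     (cnt s' + E <= q')%R -> (alive S -> num s' 0 != 0) -> wp Q (K, s') q') ->
  wp Q (node i l :: K, s) q.

Lemma wp_restrict i c c2 s S v K Q q :
  vtx s (10 * i) = Some v -> vset s (10 * i + c) = S c ->
  wp Q (K, set_vset s (10 * i + 10 + c) (restricted S c2 v c)) q ->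
  wp Q (restrict i c c2 :: K, s) q.
Proof.
move=> vE SE H; apply: wp_det => //=.
by move: H; rewrite /restricted; case: ifP => _ /=; rewrite vE SE.
Qed.

Definition unhit A D : {set V} := [set b in A | [forall v in D, ~~ e v b]].

Definition child_credit i l S c2 v : R :=
  (1 + ecost i l + theta * branching i l * (leaves l (restricted S c2 v))%:R)%R.

Definition unhit_credit S c1 c2 D : R :=
  (\sum_(b in unhit (S c2) D) (1 + (deg (S c1) b)%:R))%R.

Lemma child_credit_ge0 i l S c2 v : (0 <= child_credit i l S c2 v)%R.
Proof.
have := ecost_ge0 i l; have := branching_ge0 i l.
move=> b0 e0; by rewrite addr_ge0 ?addr_ge0 // mulr_ge0 // mulr_ge0.
Qed.

Lemma unhit_credit_ge0 S c1 c2 D : (0 <= unhit_credit S c1 c2 D)%R.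
Proof. by apply: sumr_ge0 => v _; rewrite addr_ge0. Qed.

Lemma aliveP S : reflect (forall c, c < 3 -> tri c \in S c) (alive S).
Proof.
apply: (iffP and3P) => [[? ? ?] [|[|[|]]] //|H].
by split; apply: H.
Qed.

(** Register [10 * i + 7] holds the vertices of [S c2] without neighbor among the samples processed
    so far; the credit for searching the final such set is set aside from the start. *)
Lemma wp_pass i l c1 c2 c3 j s S (q E : R) K Q :
  node_spec i.+1 l ->
  c1 < 3 -> c2 < 3 -> c3 < 3 -> j < 3 -> c1 != c2 -> c2 != c3 -> c1 != c3 ->
  ctx s -> (forall c, c < 3 -> vset s (10 * i + c) = S c) -> (0 <= E)%R ->
  let D := vset s (10 * i + 3 + j) in
  (cnt s + E + \sum_(v in D) child_credit i.+1 l S c2 v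
     + unhit_credit S c1 c2 D <= q)%R ->
  (forall s' (q' : R),
     agree (fun x => (x < 10 * i + 7) && (x != 10 * i + 3 + j)) (10 * i) s s' ->
     (cnt s' + E <= q')%R ->
     (alive S -> tri c1 \notin D -> tri c3 \notin D -> num s' 0 != 0) ->
     wp Q (K, s') q') ->
  wp Q (pass (node i.+1 l) i c1 c2 c3 j :: K, s) q.
Proof.
move=> spec lt1 lt2 lt3 ltj n12 n23 n13 ctx_s SE E0 D leq HK.
pose keep := fun x => (x < 10 * i + 7) && (x != 10 * i + 3 + j).
have kS c : c < 3 -> keep (10 * i + c) by rewrite /keep => ltc; reg_lia.
do 2 (apply: wp_det => //=); rewrite SE //; apply: wp_det => //=.
set s0 := set_vset _ _ _.
have ag0 : agree keep (10 * i) s s0.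
  by apply: agree_vset; [rewrite /keep; reg_lia|apply: agree_refl].
have D0 : vset s0 (10 * i + 3 + j) = D by rewrite vset_set_neq //; reg_lia.
have R0 : vset s0 (10 * i + 7) = S c2 by rewrite vset_set_eq.
have c0 : cnt s0 = cnt s by [].
move: s0 ag0 D0 R0 c0 => s0 ag0 D0 R0 c0.
pose E1 : R := (E + unhit_credit S c1 c2 D)%R.
have E10 : (0 <= E1)%R by rewrite addr_ge0 // unhit_credit_ge0.
have sum_ge0 T : (0 <= \sum_(v in T) child_credit i.+1 l S c2 v)%R.
  by apply: sumr_ge0 => v _; apply: child_credit_ge0.
pose I (T : {set V}) s' (q' : R) := [/\ agree keep (10 * i) s s',
  vset s' (10 * i + 7) = unhit (S c2) (D :\: T),
  (cnt s' + E1 + \sum_(v in T) child_credit i.+1 l S c2 v <= q')%R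
  & T \subset D /\
    forall v, v \in D :\: T -> alive (restricted S c2 v) -> num s' 0 != 0].
apply: (wp_foreach (I := I)).
- move=> T s1 q1 [/ctx_agree ag1 _ le1 _]; have [_ -> _] := ag1 ctx_s; split=> //.
  by have := sum_ge0 T; lra.
- by move=> T s1 q1 u [ag1 R1 le1 f1]; split=> //; apply: agree_vtx.
- move=> T s1 q1 v [ag1 R1 le1 [TD f1]] vT vE ET.
  set s2 := set_vset _ _ _.
  have ag2 : agree keep (10 * i) s s2.
    by apply: agree_vset; [rewrite /keep eqxx andbF|apply: agree_num].
  have R2 : vset s2 (10 * i + 7) = unhit (S c2) (D :\: T).
    by rewrite vset_set_neq //; reg_lia.
  have T2 : vset s2 (10 * i + 3 + j) = T :\ v by rewrite vset_set_eq.
  have le2 : (cnt s2 + (E1 + \sum_(w in T :\ v) child_credit i.+1 l S c2 w) +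
      ecost i.+1 l + theta * branching i.+1 l * (leaves l (restricted S c2 v))%:R
      <= q1)%R.
    have -> : cnt s2 = (cnt s1 + 1)%R by rewrite /cnt /= /upd /= -natr1.
    by move: le1; rewrite (big_setD1 v vT) /= /child_credit; lra.
  have v2 : vtx s2 (10 * i) = Some v by [].
  have f2 : num s2 0 = num s1 0 by [].
  move: s2 ag2 R2 T2 le2 v2 f2 => s2 ag2 R2 T2 le2 v2 f2.
  have S2 c : c < 3 -> vset s2 (10 * i + c) = S c.
    by have [vs _ _ _] := ag2; move=> ltc; rewrite vs ?kS ?SE.
  do 3 (apply: wp_det => //=); rewrite v2 R2.
  set R3 := (unhit _ _ :\: _).
  have R3E : R3 = unhit (S c2) (D :\: (T :\ v)).
    apply/setP => b; rewrite /R3 !inE andbCA; congr (_ && _).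
    apply/andP/forall_inP => [[nvb /forall_inP unh] w|unh].
      rewrite !inE negb_and negbK => /andP[/orP[/eqP -> //|wT] wD].
      by apply: unh; rewrite inE wT.
    split; first by apply: unh; rewrite !inE eqxx (subsetP TD).
    by apply/forall_inP => w /setDP[wD wT]; apply: unh; rewrite !inE wD (negPf wT) andbF.
  do 3 (apply: (wp_restrict (S := S) (v := v));
    [exact: v2|by rewrite ?vset_set_neq ?S2 //; reg_lia|apply: wp_det => //]).
  set s3 := set_vset _ _ _.
  have ag3 : agree keep (10 * i) s s3.
    by do 4 (apply: agree_vset; first by rewrite /keep; reg_lia).
  have S3 c : c < 3 -> vset s3 (10 * i.+1 + c) = restricted S c2 v c.
    move=> ltc; have -> : 10 * i.+1 + c = 10 * i + 10 + c by reg_lia.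
    have [->|n2] := eqVneq c 2; first by rewrite vset_set_eq.
    rewrite vset_set_neq; last by move: n2; reg_lia.
    have [->|n1] := eqVneq c 1; first by rewrite vset_set_eq.
    rewrite vset_set_neq; last by move: n1; reg_lia.
    by have -> : c = 0; [move: n1 n2; reg_lia|rewrite vset_set_eq].
  have R3' : vset s3 (10 * i + 7) = R3.
    by rewrite /s3; do 3 (rewrite vset_set_neq; last by reg_lia); apply: vset_set_eq.
  have T3 : vset s3 (10 * i + 3 + j) = T :\ v.
    by rewrite /s3; do 4 (rewrite vset_set_neq; last by reg_lia).
  have f3 : num s3 0 = num s2 0 by [].
  have c3' : cnt s3 = cnt s2 by [].
  move: s3 ag3 S3 R3' T3 f3 c3' => s3 ag3 S3 R3' T3 f3 c3'.
  apply: (spec s3 (restricted S c2 v) q1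
    (E1 + \sum_(w in T :\ v) child_credit i.+1 l S c2 w)%R) => //.
  + exact: (ctx_agree ag3 ctx_s).
  + exact: addr_ge0.
  + by rewrite c3'.
  move=> s4 q4 ag4 le4 f4; apply: wp_det => //; apply: wp_halt.
  have [vs4 _ _ mono4] := ag4.
  split; first by rewrite vs4 //; reg_lia.
  split.
  + by apply: agree_trans ag3 ag4 _ _; [move=> x; rewrite /keep|]; reg_lia.
  + by rewrite vs4 ?R3' //; reg_lia.
  + by move: le4; lra.
  + split=> [|w]; first exact: subset_trans (subD1set _ _) TD.
    have [-> _ //|nwv] := eqVneq w v.
    by rewrite !inE nwv => wT alw; apply: mono4; rewrite f3 f2; apply: f1 alw; rewrite inE.
- move=> s1 q1 [ag1 R1 le1 [_ f1]]; rewrite setD0 in R1 f1.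
  have ctx1 := ctx_agree ag1 ctx_s.
  have S1 c : c < 3 -> vset s1 (10 * i + c) = S c.
    by have [vs _ _ _] := ag1; move=> ltc; rewrite vs ?kS ?SE.
  apply: wp_det => //; apply: (@wp_brute _ c1 c2 c3 _ _ E) => //.
  + by case: ctx1.
  + by move: le1; rewrite big_set0 R1 S1 // /E1 /unhit_credit; lra.
  move=> s2 q2 ag2 le2 f2; apply: wp_det => //; apply: HK => //.
    apply: agree_trans ag1 ag2 _ _; last by reg_lia.
    by move=> x; rewrite /keep => /andP[].
  move=> /aliveP al n1 n3; have [_ _ _ mono2] := ag2.
  have [/existsP[v /andP[vD evb]]|] := boolP [exists v in D, e v (tri c2)].
    apply: mono2; apply: (f1 v vD); apply/aliveP => c ltc.
    rewrite /restricted; case: eqP => [->|/eqP nc2].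
      by rewrite !inE evb al.
    rewrite !inE al // andbT; apply: contraTneq vD => <-.
    have [->|->] // : c = c1 \/ c = c3.
    by move: nc2 n12 n23 n13; reg_lia.
  rewrite negb_exists => /forallP nh; apply: f2; rewrite ?R1 ?S1 ?al //.
  rewrite inE al //=; apply/forall_inP => v vD.
  by have := nh v; rewrite vD.
- split=> //.
  + by rewrite R0 D0 setDv; apply/setP => b; rewrite !inE; case: (b \in _) => //=; apply/esym/forall_inP => w; rewrite inE.
  + by rewrite D0 c0 /E1; lra.
  + by rewrite D0; split=> // v; rewrite setDv inE.
Qed.

(* Credit held for one of the samples while [T] is still to be sampled from: the
   credit of its children, present and expected, and for each [b] the cost of the
   direct search times the probability that [b] stays without sampled neighbor. *)
Definition potential S c1 c2 (w : V -> R) (p : R) D T : R :=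
  (\sum_(v in D) w v + p * \sum_(v in T) w v +
   \sum_(b in unhit (S c2) D)
      (1 + (deg (S c1) b)%:R) * (1 - p) ^+ #|nbhd b :&: T|)%R.

(** A martingale identity for the decision whether [u] is sampled. A vertex [b] adjacent to [u]
    stays unhit only if [u] is rejected, and that factor [1 - p] replaces the one lost when [u]
    leaves [T]; for other [b] nothing changes. *)
Lemma potential_step S c1 c2 w p D T u : u \in T -> u \notin D ->
  (p * potential S c1 c2 w p (u |: D) (T :\ u)
   + (1 - p) * potential S c1 c2 w p D (T :\ u))%R = potential S c1 c2 w p D T.
Proof.
move=> uT uD; rewrite /potential (big_setU1 _ uD) /= (big_setD1 u uT) /=.
rewrite !(big_mkcond (fun b => b \in unhit _ _)) /=.
set x := (\sum_(v in D) w v)%R; set y := (\sum_(v in T :\ u) w v)%R.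
set a := (\sum_b _)%R; set b := (\sum_b _)%R; set c := (\sum_b _)%R.
suff <- : (p * a + (1 - p) * b = c)%R by ring.
rewrite /a /b /c !mulr_sumr -big_split /=; apply: eq_bigr => z _.
have unhitU : (z \in unhit (S c2) (u |: D)) = ~~ e u z && (z \in unhit (S c2) D).
  rewrite !inE andbCA; congr (_ && _).
  apply/forall_inP/andP => [H|[nuz /forall_inP H] v].
    split; first by apply: H; rewrite setU11.
    by apply/forall_inP => v vD; apply: H; rewrite inE vD orbT.
  by rewrite !inE => /orP[/eqP-> //|]; apply: H.
rewrite unhitU; case: (z \in unhit (S c2) D); last by rewrite andbF; ring.
rewrite andbT; have [euz|neuz] /= := boolP (e u z).
  rewrite (cardsD1 u (nbhd z :&: T)) !inE uT e_sym euz /=.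
  have -> : (nbhd z :&: T) :\ u = nbhd z :&: (T :\ u) by rewrite setIDA.
  by rewrite exprS; ring.
have -> : nbhd z :&: (T :\ u) = nbhd z :&: T.
  apply/setP => v; rewrite !inE; case: eqP => [->|//].
  by rewrite e_sym (negPf neuz).
by ring.
Qed.

Lemma sum_window (a m N : nat) (x y : R) : a + m <= N ->
  (\sum_(r < N) (if (a <= r)%N && ~~ (a + m <= r)%N then x else y)
   = m%:R * x + (N%:R - m%:R) * y)%R.
Proof.
move=> le_N; rewrite -(big_mkord xpredT (fun r => if (a <= r) && ~~ (a + m <= r) then x else y)).
rewrite (big_cat_nat (n := a)) //=; last by lia.
rewrite (big_cat_nat (n := a + m) (m := a)) //=; last by lia.
rewrite (eq_big_nat _ _ (F2 := fun=> y)); last by move=> r ltr; rewrite ifN //; lia.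
rewrite [X in (_ + (X + _))%R](eq_big_nat _ _ (F2 := fun=> x)); last first.
  by move=> r ltr; rewrite ifT //; lia.
rewrite [X in (_ + (_ + X))%R](eq_big_nat _ _ (F2 := fun=> y)); last first.
  by move=> r ltr; rewrite ifN //; lia.
rewrite !sumr_const_nat subn0 addKn.
have -> : N = a + m + (N - (a + m)) by lia.
rewrite addKn; move: (N - _) => z; rewrite !natrD -!(mulr_natl x) -!(mulr_natl y); ring.
Qed.

Lemma neval_epow6 s k : num s 6 = X -> neval B s (epow (ereg 6) k) = minn B (X ^ k).
Proof.
move=> XE; elim: k => [|k IH] //.
by rewrite expnS -minn_cap -IH /= XE.
Qed.

Lemma wp_put_sample i j s u r D K Q q :
  j < 3 -> 3 * X ^ 2 ^ i <= B -> r <= B -> vtx s (10 * i) = Some u ->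
  num s 6 = X -> num s 5 = r -> vset s (10 * i + 3 + j) = D ->
  wp Q (K, set_vset s (10 * i + 3 + j)
     (if (j * X ^ 2 ^ i <= r) && ~~ (j * X ^ 2 ^ i + X ^ 2 ^ i <= r)
      then u |: D else D)) q ->
  wp Q (put_sample i j :: K, s) q.
Proof.
move=> ltj leB leR uE XE rE DE H; apply: wp_det => //.
move: H; rewrite /= !(neval_epow6 _ XE) rE (minn_idPr leR) !minn_cap.
have -> : minn B (j * X ^ 2 ^ i) = j * X ^ 2 ^ i by nia.
have -> : minn B (j.+1 * X ^ 2 ^ i) = j * X ^ 2 ^ i + X ^ 2 ^ i by nia.
case: ifP => _ H; first by apply: wp_det => //=; rewrite uE DE.
(* Outside the window nothing is written; writing back the old value is the identity by function
   extensionality. *)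
apply: wp_det => //=; suff <- : set_vset s (10 * i + 3 + j) D = s by [].
rewrite -DE; case: (s) => a b c; congr State.
by apply/boolp.funext => k; rewrite /upd; case: eqP => [->|].
Qed.

(** This makes the three samples disjoint: one random number decides about all of them. *)
Lemma window_inj x r j j' :
  (j * x <= r) && ~~ (j * x + x <= r) -> (j' * x <= r) && ~~ (j' * x + x <= r) ->
  j = j'.
Proof.
move=> /andP[H1 H2] /andP[H3 H4].
have x0 : 0 < x by lia.
have lt1 : j < j'.+1 by rewrite -(ltn_pmul2r x0); lia.
have lt2 : j' < j.+1 by rewrite -(ltn_pmul2r x0); lia.
by lia.
Qed.

Lemma potential_set0 S c1 c2 w p D :
  potential S c1 c2 w p D set0 = (\sum_(v in D) w v + unhit_credit S c1 c2 D)%R.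
Proof.
rewrite /potential big_set0 mulr0 addr0; congr (_ + _)%R.
by apply: eq_bigr => b _; rewrite setI0 cards0 expr0 mulr1.
Qed.

(** Rate of a single sample: a window of width [X ^ 2 ^ i] among [3 * n] values. The three samples
    together have the rate used in [branching]. *)
Let p_ i : R := ((X ^ 2 ^ i)%:R / (3 * n))%R.

Lemma wp_sample i c1 c2 (w : V -> R) s S (q E : R) K Q :
  c1 < 3 -> 0 < #|V| -> X ^ 2 ^ i <= #|V| -> 3 * #|V| <= B ->
  (forall v, 0 <= w v)%R ->
  ctx s -> (forall c, c < 3 -> vset s (10 * i + c) = S c) -> (0 <= E)%R ->
  (cnt s + E + #|S c1|%:R + 3 * potential S c1 c2 w (p_ i) set0 (S c1) <= q)%R ->
  (forall s' (q' : R), agree (fun j => j < 10 * i + 3) (10 * i) s s' ->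
     (forall j j' v, j < 3 -> j' < 3 -> v \in vset s' (10 * i + 3 + j) ->
        v \in vset s' (10 * i + 3 + j') -> j = j') ->
     (cnt s' + E + \sum_(j < 3) (\sum_(v in vset s' (10 * i + 3 + j)) w v
        + unhit_credit S c1 c2 (vset s' (10 * i + 3 + j))) <= q')%R ->
     wp Q (K, s') q') ->
  wp Q (sample i c1 :: K, s) q.
Proof.
move=> lt1 n0 Xn nB w0 ctx_s SE E0 leq HK.
have p0 : (0 <= p_ i)%R by rewrite /p_ divr_ge0 // mulr_ge0 // /n ler0n.
have nR : (0 < n)%R by rewrite /n ltr0n.
have p1 : (p_ i <= 1)%R.
  have : ((X ^ 2 ^ i)%:R <= n)%R by rewrite /n ler_nat.
  by rewrite /p_ ler_pdivrMr ?mulr_gt0 //; lra.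
have pE : ((X ^ 2 ^ i)%:R = (3 * #|V|)%:R * p_ i)%R.
  by rewrite /p_ natrM -/n mulrC divfK // mulf_neq0 ?gt_eqF.
have pot0 D T : (0 <= potential S c1 c2 w (p_ i) D T)%R.
  apply: addr_ge0; last apply: sumr_ge0 => b _.
    by apply: addr_ge0; [exact: sumr_ge0|apply: mulr_ge0 => //; exact: sumr_ge0].
  by rewrite mulr_ge0 ?addr_ge0 // exprn_ge0 // subr_ge0.
have kS c : c < 3 -> 10 * i + c < 10 * i + 3 by move=> ltc; reg_lia.
do 8 (apply: wp_det => //=); rewrite /upd !ifN ?SE //; try by reg_lia.
set s0 := set_vset _ _ _.
have ag0 : agree (fun j => j < 10 * i + 3) (10 * i) s s0.
  by do 4 (apply: agree_vset; first by reg_lia); apply: agree_refl.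
have D0 j : j < 3 -> vset s0 (10 * i + 3 + j) = set0.
  move=> ltj; rewrite /s0 vset_set_neq; last by reg_lia.
  have [->|n2] := eqVneq j 2; first by rewrite -addnA vset_set_eq.
  rewrite vset_set_neq; last by move: n2; reg_lia.
  have [->|n1] := eqVneq j 1; first by rewrite -addnA vset_set_eq.
  rewrite vset_set_neq; last by move: n1; reg_lia.
  by have -> : j = 0; [move: n1 n2; reg_lia|rewrite addn0 vset_set_eq].
have R0 : vset s0 (10 * i + 6) = S c1 by rewrite vset_set_eq.
have cnt0 : cnt s0 = cnt s by [].
move: s0 ag0 D0 R0 cnt0 => s0 ag0 D0 R0 cnt0.
apply: wp_det => //.
pose I (T : {set V}) s' (q' : R) := [/\ agree (fun j => j < 10 * i + 3) (10 * i) s s',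
  (forall j j' v, j < 3 -> j' < 3 -> v \in vset s' (10 * i + 3 + j) ->
     v \in vset s' (10 * i + 3 + j') -> j = j'),
  (forall j v, j < 3 -> v \in vset s' (10 * i + 3 + j) -> v \notin T)
  & (cnt s' + E + #|T|%:R + \sum_(j < 3)
       potential S c1 c2 w (p_ i) (vset s' (10 * i + 3 + j)) T <= q')%R].
apply: (wp_foreach (I := I)).
- move=> T s1 q1 [/ctx_agree ag1 _ _ le1]; have [_ -> _] := ag1 ctx_s; split=> //.
  have : (0 <= \sum_(j < 3) potential S c1 c2 w (p_ i) (vset s1 (10 * i + 3 + j)) T)%R.
    exact: sumr_ge0.
  by have := ler0n R #|T|; lra.
- by move=> T s1 q1 u [ag1 dis1 nT1 le1]; split=> //; apply: agree_vtx.
- move=> T s1 q1 u [ag1 dis1 nT1 le1] uT uE ET.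
  set s2 := set_vset _ _ _.
  have ag2 : agree (fun j => j < 10 * i + 3) (10 * i) s s2.
    by apply: agree_vset; [reg_lia|apply: agree_num].
  have D2 j : j < 3 -> vset s2 (10 * i + 3 + j) = vset s1 (10 * i + 3 + j).
    by move=> ltj; rewrite vset_set_neq //; reg_lia.
  have T2 : vset s2 (10 * i + 6) = T :\ u by rewrite vset_set_eq.
  have cT : (#|T|%:R = #|T :\ u|%:R + 1 :> R)%R by rewrite (cardsD1 u T) uT natrD addrC.
  have cnt2 : cnt s2 = (cnt s1 + 1)%R by rewrite /cnt /= /upd /= -natr1.
  have u2 : vtx s2 (10 * i) = Some u by [].
  move: s2 ag2 D2 T2 cnt2 u2 => s2 ag2 D2 T2 cnt2 u2.
  have [n2 _ X2] := ctx_agree ag2 ctx_s.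
  apply: wp_det => //=.
  pose Dn r j := if (j * X ^ 2 ^ i <= r) && ~~ (j * X ^ 2 ^ i + X ^ 2 ^ i <= r)
    then u |: vset s1 (10 * i + 3 + j) else vset s1 (10 * i + 3 + j).
  pose g r : R := (cnt s1 + 1 + E + #|T :\ u|%:R
    + \sum_(j < 3) potential S c1 c2 w (p_ i) (Dn r j) (T :\ u))%R.
  have arE : arity B e (crand 5 (emul (econst 3) (ereg 2))) s2 = 3 * #|V|.
    by rewrite /= n2 minn_cap (minn_idPr nB) (maxn_idPr _) // muln_gt0 n0.
  apply: (wp_step (g := g)); rewrite arE; last first.
    (* Linearity of expectation: the three samples are dependent, but each alone takes [u] with
       probability [p_ i], so [potential_step] applies to each. *)
    rewrite big_split /= sumr_const card_ord exchange_big /=.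
    rewrite (eq_bigr (fun j : 'I_3 => (3 * #|V|)%:R *
       potential S c1 c2 w (p_ i) (vset s1 (10 * i + 3 + j)) T)%R); last first.
      move=> j _; rewrite -(potential_step S c1 c2 w (p_ i) uT); last first.
        by apply/negP => uD; have := nT1 j u (ltn_ord j) uD; rewrite uT.
      under eq_bigr do rewrite /Dn (fun_if (fun D => potential S c1 c2 w (p_ i) D (T :\ u))).
      rewrite sum_window; last by rewrite -mulSnr leq_mul // ltn_ord.
      by rewrite pE; ring.
    rewrite -mulr_sumr -[(_ *+ (3 * _))%R]mulr_natl -mulrDr mulrC.
    by rewrite ler_wpM2r ?ler0n //; move: le1; rewrite cT; lra.
  move=> r ltr /=.
  set s3 := set_num s2 5 r.
  have ag3 : agree (fun j => j < 10 * i + 3) (10 * i) s s3 by apply: agree_num.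
  have r3 : num s3 5 = r by [].
  have D3 j : j < 3 -> vset s3 (10 * i + 3 + j) = vset s1 (10 * i + 3 + j) by apply: D2.
  have T3 : vset s3 (10 * i + 6) = T :\ u by [].
  have cnt3 : cnt s3 = (cnt s1 + 1)%R by [].
  have u3 : vtx s3 (10 * i) = Some u by [].
  move: s3 ag3 r3 D3 T3 cnt3 u3 => s3 ag3 r3 D3 T3 cnt3 u3.
  have [_ _ X3] := ctx_agree ag3 ctx_s.
  have lerB : r <= B by lia.
  have leXB : 3 * X ^ 2 ^ i <= B by lia.
  apply: wp_det => //; apply: (@wp_put_sample _ _ _ u r _ _ _ _ _ leXB lerB u3 X3 r3 (D3 0 _)) => //.
  set s4 := set_vset s3 _ _.
  apply: wp_det => //.
  apply: (@wp_put_sample _ _ _ u r (vset s1 (10 * i + 3 + 1)) _ _ _ _ leXB lerB) => //.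
    by rewrite /s4 vset_set_neq ?D3 //; reg_lia.
  set s5 := set_vset s4 _ _.
  apply: wp_det => //.
  apply: (@wp_put_sample _ _ _ u r (vset s1 (10 * i + 3 + 2)) _ _ _ _ leXB lerB) => //.
    by rewrite /s5 vset_set_neq ?/s4 ?vset_set_neq ?D3 //; reg_lia.
  set s6 := set_vset s5 _ _.
  apply: wp_det => //; apply: wp_halt.
  have D6 j : j < 3 -> vset s6 (10 * i + 3 + j) = Dn r j.
    case: j => [|[|[|//]]] _; rewrite /Dn.
    - rewrite /s6 vset_set_neq; last by reg_lia.
      rewrite /s5 vset_set_neq; last by reg_lia.
      by rewrite /s4 vset_set_eq.
    - rewrite /s6 vset_set_neq; last by reg_lia.
      by rewrite /s5 vset_set_eq.
    - by rewrite /s6 vset_set_eq.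
  split.
    rewrite /s6 vset_set_neq; last by reg_lia.
    rewrite /s5 vset_set_neq; last by reg_lia.
    by rewrite /s4 vset_set_neq //; reg_lia.
  split.
  + by do 3 (apply: agree_vset; first by reg_lia).
  + move=> j j' v ltj ltj'; rewrite !D6 // /Dn.
    case: ifP => cj; case: ifP => cj'; rewrite ?inE.
    * by move=> _ _; apply: window_inj cj cj'.
    * case/orP => [/eqP ->|]; last exact: dis1.
      by move=> uD; have := nT1 _ _ ltj' uD; rewrite uT.
    * move=> vD /orP[/eqP vu|]; last exact: dis1.
      by have := nT1 _ _ ltj vD; rewrite vu uT.
    * exact: dis1.
  + move=> j v ltj; rewrite D6 // /Dn; case: ifP => _; rewrite !inE.
      by case: eqP => //= _ /(nT1 _ _ ltj) ->.
    by move/(nT1 _ _ ltj)/negPf ->; rewrite andbF.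
  + rewrite /g; under eq_bigr => j _ do rewrite (D6 j (ltn_ord j)).
    by rewrite -[cnt s6]/(cnt s3) cnt3.
- move=> s1 q1 [ag1 dis1 _ le1]; apply: wp_det => //; apply: HK => //.
  move: le1; rewrite cards0 addr0.
  by under eq_bigr do rewrite potential_set0.
- split=> //.
  + by move=> j j' v ltj _; rewrite D0 ?inE.
  + by move=> j v ltj; rewrite D0 ?inE.
  + rewrite R0 cnt0; under eq_bigr => j _ do rewrite (D0 j (ltn_ord j)).
    by rewrite sumr_const card_ord -[(_ *+ 3)%R]mulr_natl.
Qed.

(** Bounds [d * (1 - p) ^ d] by [1 / p]: a vertex is either cheap to search from or likely to be
    hit. In the induction, [(1 + (d + 1) * p) * (1 - p) <= 1 + d * p]. *)
Lemma bernoulli_decay (p : R) (d : nat) :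
  (0 <= p -> p <= 1 -> (1 + d%:R * p) * (1 - p) ^+ d <= 1)%R.
Proof.
move=> p0 p1; elim: d => [|d IH]; first by rewrite mul0r addr0 expr0 mulr1.
apply: le_trans IH; rewrite exprS mulrA ler_wpM2r ?exprn_ge0 ?subr_ge0 //.
by rewrite -natr1; have := ler0n R d; nra.
Qed.

(** Each vertex contributes at most [1 + 3 * n / m]: by [bernoulli_decay] with [1 / p = 3 * n / x]
    if [x > 0], and because degrees are at most [n] if [x = 0], when nothing is sampled. *)
Lemma unhit_expectation S c1 c2 i :
  0 < #|V| -> X ^ 2 ^ i <= #|V| ->
  (\sum_(b in S c2) (1 + (deg (S c1) b)%:R) * (1 - p_ i) ^+ deg (S c1) b
   <= n + 3 * n ^+ 2 / (maxn 1 (X ^ 2 ^ i))%:R)%R.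
Proof.
move=> n0 Xn; have nR : (0 < n)%R by rewrite /n ltr0n.
set x := X ^ 2 ^ i in Xn *; set m := maxn 1 x.
have m0 : (0 < m%:R :> R)%R by rewrite ltr0n /m; lia.
have p0 : (0 <= p_ i)%R by rewrite /p_ divr_ge0 // mulr_ge0 // ltW.
have xn : (x%:R <= n)%R by rewrite /n ler_nat.
have p1 : (p_ i <= 1)%R by rewrite /p_ ler_pdivrMr ?mulr_gt0 // -/x; lra.
have bnd b : ((1 + (deg (S c1) b)%:R) * (1 - p_ i) ^+ deg (S c1) b
    <= 1 + 3 * n / m%:R)%R.
  set d := deg _ _.
  have dn : (d%:R <= n)%R by rewrite /n ler_nat max_card.
  have y0 : (0 <= (1 - p_ i) ^+ d)%R by rewrite exprn_ge0 // subr_ge0.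
  have y1 : ((1 - p_ i) ^+ d <= 1)%R by rewrite exprn_ile1 ?subr_ge0 //; lra.
  rewrite mulrDl mul1r lerD // ler_pdivlMr //.
  have [x0|x0] := posnP x.
    have -> : m = 1 by rewrite /m x0.
    by rewrite mulr1; have := ler0n R d; nra.
  have -> : m = x by rewrite /m; lia.
  have := bernoulli_decay d p0 p1.
  have pE : (x%:R = p_ i * (3 * n))%R.
    by rewrite /p_ -/x divfK // mulf_neq0 ?gt_eqF.
  rewrite pE => H.
  have -> : (d%:R * (1 - p_ i) ^+ d * (p_ i * (3 * n)) =
    (d%:R * p_ i * (1 - p_ i) ^+ d) * (3 * n))%R by ring.
  by rewrite ler_piMl ?mulr_ge0 ?(ltW nR) //; move: H; rewrite mulrDl mul1r; lra.
have n3 : (0 <= 1 + 3 * n / m%:R)%R by rewrite addr_ge0 // divr_ge0 ?mulr_ge0 // ltW.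
apply: le_trans (ler_sum _ (fun b _ => bnd b)) _.
rewrite sumr_const -[X in (X <= _)%R]mulr_natr.
apply: (@le_trans _ _ ((1 + 3 * n / m%:R) * n)%R).
  by rewrite ler_wpM2l // /n ler_nat max_card.
by rewrite mulrDl mul1r expr2 mulrAC !mulrA.
Qed.

Definition valid_levels (l : seq (nat * nat)) : bool :=
  all (fun c => [&& c.1 < 3, c.2 < 3 & c.1 != c.2]) l.

(** The factor 3 for the three samples cancels the 3 in [p_ i]. The leaf terms then match exactly,
    and the children's time is bounded through [#|S c1| <= n]. *)
Lemma sample_credit i c1 c2 l S :
  0 < #|V| -> X ^ 2 ^ i <= #|V| ->
  (#|S c1|%:R + 3 * potential S c1 c2 (child_credit i.+1 l S c2) (p_ i) set0 (S c1)
   <= ecost i ((c1, c2) :: l)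
      + theta * branching i ((c1, c2) :: l) * (leaves ((c1, c2) :: l) S)%:R)%R.
Proof.
move=> n0 Xn; have := unhit_expectation S c1 c2 n0 Xn.
have nR : (0 < n)%R by rewrite /n ltr0n.
have unhit0 : unhit (S c2) set0 = S c2.
  by apply/setP => b; rewrite inE andb_idr // => _; apply/forall_inP => v; rewrite inE.
rewrite /potential big_set0 add0r unhit0 /=.
set y := (\sum_(b in _) _)%R; set x := X ^ 2 ^ i; move=> Hy.
have -> : (\sum_(v in S c1) child_credit i.+1 l S c2 v =
  #|S c1|%:R * (1 + ecost i.+1 l) + theta * branching i.+1 l *
    (\sum_(v in S c1) leaves l (restricted S c2 v))%:R)%R.
  by rewrite natr_sum mulr_sumr big_split /= sumr_const mulr_natl.
set L := (\sum_(v in S c1) _)%N; set ec := ecost _ _; set br := branching _ _.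
have ec0 : (0 <= ec)%R by apply: ecost_ge0.
have cn : (#|S c1|%:R <= n)%R by rewrite /n ler_nat max_card.
have H1 : (3 * (p_ i * (#|S c1|%:R * (1 + ec))) <= x%:R * (1 + ec))%R.
  rewrite /p_ -/x !mulrA ler_wpM2r ?addr_ge0 //.
  have -> : (3 * x%:R / (3 * n) * #|S c1|%:R = x%:R * (#|S c1|%:R / n))%R.
    by field; rewrite gt_eqF.
  by rewrite ler_piMr // ler_pdivrMr // mul1r.
have H2 : (3 * (p_ i * (theta * br * L%:R)) = theta * (x%:R / n * br) * L%:R)%R.
  by rewrite /p_ -/x; field; rewrite gt_eqF.
move: H1 H2 Hy; rewrite mulrDr; lra.
Qed.

Lemma wp_node i l :
  0 < #|V| -> 3 * #|V| <= B -> valid_levels l ->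
  (forall i', i' < i + size l -> X ^ 2 ^ i' <= #|V|) -> node_spec i l.
Proof.
move=> n0 nB; elim: l i => [|[c1 c2] l IH] i.
  move=> _ _ s S q E K Q _ _ E0 leq HK; apply: wp_det => //.
  have cnt0 : (0 <= cnt s)%R by rewrite /cnt ler0n.
  move: leq; rewrite /=; case: (boolP (alive S)) => al leq.
    (* At an alive leaf [branching] and [leaves] are both 1, so the credit has reached [theta]. *)
    by apply: wp_abort; move: leq; rewrite !mulr1; lra.
  by apply: HK; [exact: agree_refl|move: leq; rewrite mulr0n mulr0; lra|rewrite (negPf al)].
case/andP => /and3P[/= lt1 lt2 n12] val_l leX s S q E K Q ctx_s SE E0 leq HK.
have spec : node_spec i.+1 l.
  by apply: IH => // i' lti'; apply: leX; rewrite addnS.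
have leXi : X ^ 2 ^ i <= #|V| by apply: leX; rewrite addnS; lia.
pose c3 := third c1 c2.
have lt3 : c3 < 3 by rewrite /c3 /third; lia.
have n23 : c2 != c3 by rewrite /c3 /third; lia.
have n13 : c1 != c3 by rewrite /c3 /third; lia.
have kS c : c < 3 -> 10 * i + c < 10 * i + 3 by move=> ltc; reg_lia.
pose w := child_credit i.+1 l S c2.
pose F D : R := (\sum_(v in D) w v + unhit_credit S c1 c2 D)%R.
have F0 D : (0 <= F D)%R.
  rewrite addr_ge0 ?unhit_credit_ge0 // sumr_ge0 // => v _; exact: child_credit_ge0.
apply: wp_det => //; apply: (@wp_sample _ _ c2 w _ S _ E) => //.
- by move=> v; apply: child_credit_ge0.
- by have := sample_credit c1 c2 l S n0 leXi; move: leq; rewrite -/w; lra.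
move=> s1 q1 ag1 dis.
have -> : (\sum_(j < 3) (\sum_(v in vset s1 (10 * i + 3 + j)) w v
    + unhit_credit S c1 c2 (vset s1 (10 * i + 3 + j))) =
  F (vset s1 (10 * i + 3 + 0)) + F (vset s1 (10 * i + 3 + 1))
    + F (vset s1 (10 * i + 3 + 2)))%R.
  by rewrite !big_ord_recl big_ord0 addr0 addrA.
set D0 := vset s1 (10 * i + 3 + 0); set D1 := vset s1 (10 * i + 3 + 1).
set D2 := vset s1 (10 * i + 3 + 2) => le1.
have regS s' k b : agree k b s s' -> (forall c, c < 3 -> k (10 * i + c)) ->
    forall c, c < 3 -> vset s' (10 * i + c) = S c.
  by move=> [vs _ _ _] kk c ltc; rewrite vs ?SE ?kk.
have S1 := regS _ _ _ ag1 kS; have ctx1 := ctx_agree ag1 ctx_s.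
have F_ D : F D = (\sum_(v in D) w v + unhit_credit S c1 c2 D)%R by [].
have := (F0 D0, F0 D1, F0 D2); move=> [[F00 F01] F02].
apply: wp_det => //; apply: (@wp_pass i l c1 c2 c3 0 s1 S _ (E + F D1 + F D2)) => //.
- by lra.
- by move: le1; rewrite -/D0 F_ -/w; lra.
move=> s2 q2 ag2 le2 f2.
have agt2 : agree (fun j => j < 10 * i + 3) (10 * i) s s2.
  by apply: agree_trans ag1 ag2 _ _ => // j /=; reg_lia.
have [vs2 _ _ _] := ag2.
have D21 : vset s2 (10 * i + 3 + 1) = D1 by rewrite vs2 //; reg_lia.
have D22 : vset s2 (10 * i + 3 + 2) = D2 by rewrite vs2 //; reg_lia.
apply: wp_det => //; apply: (@wp_pass i l c1 c2 c3 1 s2 S _ (E + F D2)) => //.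
- exact: ctx_agree agt2 ctx_s.
- exact: regS agt2 kS.
- by lra.
- by move: le2; rewrite D21 (F_ D1) -/w; lra.
rewrite D21 => s3 q3 ag3 le3 f3.
have agt3 : agree (fun j => j < 10 * i + 3) (10 * i) s s3.
  by apply: agree_trans agt2 ag3 _ _ => // j /=; reg_lia.
have [vs3 _ _ mono3] := ag3.
have D32 : vset s3 (10 * i + 3 + 2) = D2 by rewrite vs3 ?D22 //; reg_lia.
apply: wp_det => //; apply: (@wp_pass i l c1 c2 c3 2 s3 S _ E) => //.
- exact: ctx_agree agt3 ctx_s.
- exact: regS agt3 kS.
- by move: le3; rewrite D32 (F_ D2) -/w; lra.
rewrite D32 => s4 q4 ag4 le4 f4.
have [_ _ _ mono4] := ag4.
apply: wp_det => //; apply: HK => //.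
  by apply: agree_trans agt3 ag4 _ _ => // j /=; reg_lia.
move=> al.
have cover : [|| (tri c1 \notin D0) && (tri c3 \notin D0),
    (tri c1 \notin D1) && (tri c3 \notin D1)
  | (tri c1 \notin D2) && (tri c3 \notin D2)].
  rewrite -!negb_or -!negb_and; apply/negP => /and3P[].
  by move=> /orP[] x /orP[] y /orP[] z;
    first [by have := dis 0 1 _ isT isT x y|by have := dis 0 2 _ isT isT x z
          |by have := dis 1 2 _ isT isT y z].
case/or3P: cover => /andP[nin1 nin3].
- by apply: mono4; apply: mono3; apply: f2.
- by apply: mono4; apply: f3.
- exact: f4.
Qed.
End Triangle.
End Correct.

(** * Parameters and repetition *)

Lemma leq_powr a b k : a <= b -> a ^ k <= b ^ k.
Proof. by case: k => // k leab; rewrite leq_exp2r. Qed.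

Section Credit.
Variables (R : realType) (V : finType) (X : nat).
Hypothesis V_gt0 : 0 < #|V|.
Let n : R := #|V|%:R.

(* The sampling rates [X ^ 2 ^ i] square from one depth to the next, which makes
   [x * (n ^ 2 / x ^ 2)], the cost of all children, match the cost [n ^ 2 / x] of
   the direct search. *)
Lemma ecost_leq i (l : seq (nat * nat)) :
  (forall i', i' < i + size l -> X ^ 2 ^ i' <= #|V|) ->
  (ecost R V X i l <= 14 * (size l)%:R * n ^+ 2 / (maxn 1 (X ^ 2 ^ i))%:R)%R.
Proof.
have n1 : (1 <= n)%R by rewrite /n ler1n.
elim: l i => [|c l IH] i leX; first by rewrite /= mulr0 !mul0r.
rewrite [ecost _ _ _ _ _]/= -/n [size _]/= -[((size l).+1%:R)%R]natr1.
have {}IH := IH i.+1 (fun i' lti' => leX i' (leq_trans lti' (eq_leq (addSnnS i (size l))))).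
have ec0 := ecost_ge0 R V X i.+1 l.
have xn : ((X ^ 2 ^ i)%:R <= n)%R by rewrite /n ler_nat leX //= addnS; lia.
have X2 : X ^ 2 ^ i.+1 = X ^ 2 ^ i * X ^ 2 ^ i by rewrite -expnD addnn -mul2n -expnS.
rewrite X2 in IH; move: (X ^ 2 ^ i) xn IH => x xn IH.
set ec := ecost _ _ _ _ _ in IH ec0 *; set k : R := (size l)%:R%R in IH *.
have k0 : (0 <= k)%R by rewrite /k ler0n.
have [x0|x0] := posnP x.
  by rewrite x0 maxn0 mul0r !divr1; nra.
have xR : (1 <= x%:R :> R)%R by rewrite ler1n.
have -> : maxn 1 x = x by lia.
have x2E : maxn 1 (x * x) = x * x by nia.
rewrite x2E natrM in IH.
set y := (n ^+ 2 / x%:R)%R.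
have yE : (y * x%:R = n ^+ 2)%R by rewrite /y divfK // gt_eqF //; lra.
have ny : (n <= y)%R by rewrite /y ler_pdivlMr; nra.
have xy : (x%:R <= y)%R by lra.
have {}IH : (x%:R * ec <= 14 * k * y)%R.
  have : (x%:R * ec <= x%:R * (14 * k * n ^+ 2 / (x%:R * x%:R)))%R.
    by rewrite ler_wpM2l //; lra.
  have -> // : (x%:R * (14 * k * n ^+ 2 / (x%:R * x%:R)) = 14 * k * y)%R.
  by rewrite /y; field; rewrite gt_eqF //; lra.
have -> : (3 * n ^+ 2 / x%:R = 3 * y)%R by rewrite /y mulrA.
(* The 14 is [1 + 1 + 3 + 9]: the terms [n], [x], [3 * n] and [9 * n ^ 2 / x] of one level, each
   measured against [y] using [n <= y] and [x <= y]. *)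
have -> : (14 * (k + 1) * n ^+ 2 / x%:R = 14 * k * y + 14 * y)%R by rewrite /y; ring.
by lra.
Qed.

(** The exponents [2 ^ i, 2 ^ (i + 1), ...] of the levels form a geometric sum. *)
Lemma branchingE i (l : seq (nat * nat)) :
  (branching R V X i l * n ^+ size l = (X ^ (2 ^ i * (2 ^ size l).-1))%:R)%R.
Proof.
have nn0 : (n != 0)%R by rewrite /n pnatr_eq0 -lt0n.
elim: l i => [|c l IH] i; first by rewrite /= muln0 expn0 expr0 mulr1.
rewrite [branching _ _ _ _ _]/= -/n [size _]/= exprS.
have -> : ((X ^ 2 ^ i)%:R / n * branching R V X i.+1 l * (n * n ^+ size l) =
  (X ^ 2 ^ i)%:R * (branching R V X i.+1 l * n ^+ size l))%R by field.
rewrite IH -natrM -expnD; congr (_%:R)%R; congr (_ ^ _).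
have : 0 < 2 ^ size l by rewrite expn_gt0.
rewrite (expnS 2 i) (expnS 2 (size l)); move: (2 ^ size l) (2 ^ i) => [|r] p // _.
have -> : (2 * r.+1).-1 = 2 * r + 1 by lia.
by rewrite /=; lia.
Qed.

End Credit.


(** * Choice of [X], the tick budget, and repeated attempts *)

Section Main.
Variables (m : nat) (l : seq (nat * nat)).

Let M := size l.

(** For [m = 0] the guard is constantly false, which leaves [X = 0]. *)
Definition search_cond : bexp :=
  if m is 0 then bnot (ble (econst 0) (econst 0)) else
  band (ble (epow (eadd (ereg 6) (econst 1)) (2 ^ m.-1)) (ereg 2))
       (ble (emul (emul (econst 4) (ereg 1))
                  (epow (eadd (ereg 6) (econst 1)) (2 ^ m).-1))
            (epow (ereg 2) m)).

Definition search : cmd :=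
  bounded_while search_cond (cnum 6 (eadd (ereg 6) (econst 1))).

(** Four times the bound of [ecost_leq]. With truncated subtraction, [X + (1 - X)] is [maxn 1 X]. *)
Definition budget_exp : nexp :=
  eadd (ediv (emul (econst (56 * M)) (emul (ereg 2) (ereg 2)))
             (eadd (ereg 6) (esub (econst 1) (ereg 6)))) (econst 1).

Definition attempt : cmd :=
  cseq (cnum 3 (econst 0)) (cseq (cset 0 sall) (cseq (cset 1 sall)
    (cseq (cset 2 sall) (node 0 l)))).

Definition outer : cmd :=
  cwhile (band (bnot (ble (ereg 2) (ereg 7))) (ble (ereg 0) (econst 0)))
         (cseq attempt (cnum 7 (emul (econst 2) (ereg 7)))).

(** The word exponent leaves room for [n ^ m], [4 * t * (X + 1) ^ (2 ^ m - 1)], [3 * n] and the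
    budget, so saturation never changes the course of the program. *)
Definition algorithm : program :=
  Program (cseq (cnum 2 (ereg 0)) (cseq (cnum 0 (econst 0))
     (cseq (cnum 4 (ereg 2)) (cseq search (cseq (cnum 4 budget_exp)
     (cseq (cnum 7 (econst 1)) outer))))))
   (2 ^ m + m + 56 * M + 10).

(** The second condition keeps the sampling rates at all depths at most 1; the third bounds the
    probability of survival by 1/4. *)
Definition admissible (n t X : nat) : bool :=
  [&& 0 < m, X ^ 2 ^ m.-1 <= n & 4 * t * X ^ (2 ^ m).-1 <= n ^ m].

Definition optimal (n t X : nat) : bool :=
  ((X == 0) || admissible n t X) && ~~ admissible n t X.+1.

Definition budget (n X : nat) : nat := (56 * M * (n * n)) %/ maxn 1 X + 1.

Definition attempt_time (n X : nat) : nat :=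
  8 + 3 * n.+1 + n.+1 * (weight (node 0 l) * (budget n X).+1).

Section Run.
Variables (R : realType) (V : finType) (e : rel V) (t : nat).
Hypotheses (V_gt0 : 0 < #|V|) (e_sym : symmetric e).
Hypotheses (l_valid : valid_levels l) (M_gt0 : 0 < M) (mM : m = 0 \/ m = M).
Implicit Types (s : state V) (K : seq cmd).

Let n := #|V|.
Let N := n + t + 2.
Let B := prog_bound algorithm V t.

Lemma BE : B = N ^ (2 ^ m + m + 56 * M + 10). Proof. by []. Qed.

Lemma N_ge3 : 2 < N. Proof. by rewrite /N /n; lia. Qed.

Lemma expN_leq a : a <= 2 ^ m + m + 56 * M + 10 -> N ^ a <= B.
Proof. by move=> lea; rewrite BE leq_exp2l //; have := N_ge3; lia. Qed.

Lemma leq_expN k : k <= N ^ k.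
Proof.
apply: leq_trans (ltnW (ltn_expl k (ltnSn 1))) _.
by rewrite leq_powr //; have := N_ge3; lia.
Qed.

Lemma minn_cap_add x y : minn B (minn B x + minn B y) = minn B (x + y).
Proof. lia. Qed.

Lemma neval_epow s a x k :
  neval B s a = minn B x -> neval B s (epow a k) = minn B (x ^ k).
Proof.
by move=> aE; elim: k => [|k IH] //=; rewrite IH aE minn_cap ?expnS.
Qed.

Lemma leq_minB x y : x <= B -> y <= B -> (minn B x <= minn B y) = (x <= y).
Proof. by move=> /minn_idPr-> /minn_idPr->. Qed.

Lemma outcome_while b c K s r : outcome B e (cwhile b c) K s r =
  (if beval B e s b then [:: c, cwhile b c & K] else K, s).
Proof. by []. Qed.

Lemma search_condE s : num s 1 = t -> num s 2 = n -> num s 6 <= n ->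
  beval B e s search_cond = admissible n t (num s 6).+1.
Proof.
rewrite /search_cond /admissible => t1 n2 leX.
case: m BE expN_leq => [|m'] BE' exp_leq; first by [].
have X1 : neval B s (eadd (ereg 6) (econst 1)) = minn B (num s 6).+1.
  by rewrite /= minn_cap_add addn1.
have leXN : (num s 6).+1 <= N by rewrite /N; lia.
have p2 : 0 < 2 ^ m'.+1 by rewrite expn_gt0.
have e1 : (num s 6).+1 ^ 2 ^ m' <= B.
  apply: leq_trans (exp_leq (2 ^ m') _); last by rewrite expnS; lia.
  by rewrite leq_powr.
have e2 : (num s 6).+1 ^ (2 ^ m'.+1).-1 <= N ^ (2 ^ m'.+1).
  apply: leq_trans (leq_powr _ leXN) _.
  by rewrite leq_exp2l ?leq_pred //; have := N_ge3; lia.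
have e3 : 4 * t * (num s 6).+1 ^ (2 ^ m'.+1).-1 <= B.
  apply: leq_trans (exp_leq (3 + 2 ^ m'.+1) _); last by lia.
  rewrite expnD leq_mul // (expnD _ 2 1) leq_mul //.
    by rewrite (leq_trans (_ : _ <= 3 ^ 2)) // leq_powr // N_ge3.
  by rewrite expn1 /N; lia.
have e4 : n ^ m'.+1 <= B.
  apply: leq_trans (exp_leq m'.+1 _); last by lia.
  by rewrite leq_powr // /N; lia.
have nB : n <= B.
  apply: leq_trans (exp_leq 1 _); last by lia.
  by rewrite expn1 /N; lia.
have beE a b c d : beval B e s (band (ble a b) (ble c d)) =
  (neval B s a <= neval B s b) && (neval B s c <= neval B s d) by [].
have muE a b : neval B s (emul a b) = minn B (neval B s a * neval B s b) by [].
have reE i : neval B s (ereg i) = minn B (num s i) by [].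
have n2' : neval B s (ereg 2) = minn B n by rewrite reE n2.
rewrite beE !muE !(neval_epow _ X1) (neval_epow _ n2') n2' reE t1.
have cE c : neval B s (econst c) = minn B c by [].
by rewrite cE (minn_cap B 4 t) !minn_cap -expnS !leq_minB.
Qed.

Lemma n_leqB : 3 * n <= B.
Proof.
apply: leq_trans (expN_leq (a := 2) _); last by lia.
by rewrite expnS expn1 leq_mul // /N; lia.
Qed.

Lemma admissible_leq X : admissible n t X -> X <= n.
Proof.
case/and3P => _ + _; apply: leq_trans.
by rewrite -{1}(expn1 X); case: X => // X; rewrite leq_pexp2l // expn_gt0.
Qed.

(** The tick limit [n] never ends the search early, since an admissible [X] is at most [n]. Ticks
    and [X] count in step. *)
Lemma search_spec k s : n - num s 3 <= k -> num s 3 = num s 6 ->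
  num s 6 = 0 \/ admissible n t (num s 6) ->
  num s 1 = t -> num s 2 = n -> num s 4 = n ->
  exists T s', [/\ forall K, det B e T (search :: K, s) (K, s'),
    T <= 4 * k + 1, optimal n t (num s' 6)
    & [/\ num s' 0 = num s 0, num s' 1 = t & num s' 2 = n]].
Proof.
elim: k s => [|k IH] s lek E36 adm6 t1 n2 n4.
all: have le6 : num s 6 <= n by case: adm6 => [->//|/admissible_leq].
all: have nB : n <= B by have := n_leqB; lia.
all: have gdE : beval B e s (band search_cond (bnot (ble (ereg 4) (ereg 3)))) =
  admissible n t (num s 6).+1 && (num s 6 < n).
1,3: by rewrite -(search_condE t1 n2 le6) /= n4 E36 !leq_minB -?ltnNge //; lia.
all: have opt : ~~ (admissible n t (num s 6).+1 && (num s 6 < n)) -> optimal n t (num s 6).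
1,3: rewrite /optimal negb_and => nadm; apply/andP; split; first by case: adm6 => ->; rewrite ?eqxx ?orbT.
1,2: by case/orP: nadm => // ge6; apply/negP => /admissible_leq; lia.
- have stop : ~~ (admissible n t (num s 6).+1 && (num s 6 < n)).
    by rewrite negb_and; apply/orP; right; lia.
  exists 1, s; split=> //; last exact: opt.
  move=> K; apply: (det_next (T := 0)) => //.
  by rewrite outcome_while gdE (negPf stop); apply: det_refl.
- have [stop|/negPn go] := boolP (~~ (admissible n t (num s 6).+1 && (num s 6 < n))).
    exists 1, s; split=> //; last exact: opt.
    move=> K; apply: (det_next (T := 0)) => //.
    by rewrite outcome_while gdE (negPf stop); apply: det_refl.
  pose s1 := set_num (set_num s 3 (num s 3).+1) 6 (num s 6).+1.
  have go' := go; case/andP: go' => adm lt6.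
  have [|||T [s' [dets leT opt' [e0 e1 e2]]]] := IH s1 _ _ _ t1 n2 n4.
  - by rewrite /s1 /= /upd /=; lia.
  - by rewrite /s1 /= /upd /= E36.
  - by right.
  exists (4 + T), s'; split=> //; last by lia.
  move=> K; apply: (det_next (T := 3 + T)) => //.
  rewrite outcome_while gdE go.
  apply: (det_next (T := 2 + T)) => //.
  have gd : ~~ (neval B s (ereg 4) <= neval B s (ereg 3)).
    by rewrite /= n4 E36 leq_minB //; lia.
  have B0 : 0 < B by have := n_leqB; lia.
  have [_ tickE _] := tick_spec e B0 gd.
  apply: (det_next (T := 1 + T)) => //; rewrite tickE.
  apply: (det_next (T := T)) => //.
  suff -> : outcome B e (cnum 6 (eadd (ereg 6) (econst 1))) (search :: K)
    (set_num s 3 (num s 3).+1) 0 = (search :: K, s1) by apply: dets.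
  by rewrite /= /upd /= minn_cap_add addn1 (minn_idPr _) //; lia.
Qed.

Section Attempts.
Variable X : nat.
Hypothesis X_opt : optimal n t X.
Let bud := budget n X.

Lemma X_pow_leq i : i < M -> X ^ 2 ^ i <= n.
Proof.
move=> ltiM; case/andP: X_opt => /orP[/eqP->|/and3P[m0 leXn _] _].
  by rewrite exp0n // expn_gt0.
case: (posnP X) => [->|X0]; first by rewrite exp0n // expn_gt0.
have mE : m = M by case: mM => // m00; rewrite m00 in m0.
apply: leq_trans leXn; rewrite leq_pexp2l // leq_pexp2l // mE; lia.
Qed.

Lemma X_leq : X <= n.
Proof. by rewrite -[X]expn1 -(expn0 2) X_pow_leq. Qed.

Lemma bud_leqB : bud <= B.
Proof.
apply: (@leq_trans (N ^ (56 * M + 3))); last by apply: expN_leq; lia.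
have N3 := N_ge3.
have nN : n <= N by rewrite /N; lia.
have H : 56 * M * (n * n) <= N ^ (56 * M + 2).
  by rewrite expnD leq_mul ?leq_expN // expnS expn1 leq_mul.
have H1 : 0 < N ^ (56 * M + 2) by rewrite expn_gt0; lia.
rewrite /bud /budget (addnS _ 2) expnS.
have H2 : 2 * N ^ (56 * M + 2) <= N * N ^ (56 * M + 2) by rewrite leq_mul //; lia.
by have := leq_div (56 * M * (n * n)) (maxn 1 X); lia.
Qed.

Definition ready s : Prop :=
  [/\ num s 0 != 0 -> has_triangle e, num s 2 = n, num s 4 = bud & num s 6 = X].

Definition started s : state V :=
  set_vset (set_vset (set_vset (set_num s 3 0) 0 setT) 1 setT) 2 setT.

Definition continuation : seq cmd := [:: cnum 7 (emul (econst 2) (ereg 7)); outer].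

Lemma outer_guard s : ready s -> num s 7 <= 2 * n ->
  beval B e s (band (bnot (ble (ereg 2) (ereg 7))) (ble (ereg 0) (econst 0))) =
  (num s 7 < n) && (num s 0 == 0).
Proof.
case=> _ n2 _ _ le7; have := n_leqB => nB /=; rewrite n2 minn0.
rewrite leq_minB; [|lia|lia]; rewrite -ltnNge; congr (_ && _).
by case: (num s 0) => [|k] //=; apply/negbTE; lia.
Qed.

Lemma outer_stop s : ready s -> num s 7 <= 2 * n ->
  (n <= num s 7) || (num s 0 != 0) -> det B e 1 ([:: outer], s) ([::], s).
Proof.
move=> rdy le7 stop; apply: (det_next (T := 0)) => //.
rewrite outcome_while (outer_guard rdy le7) ifN; first exact: det_refl.
by rewrite negb_and -leqNgt.
Qed.

Lemma outer_start s : ready s -> num s 7 < n -> num s 0 = 0 ->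
  det B e (7 + 3 * n.+1) ([:: outer], s) (node 0 l :: continuation, started s).
Proof.
move=> rdy lt7 n0.
have go : (num s 7 < n) && (num s 0 == 0) by rewrite lt7 n0.
have le7 : num s 7 <= 2 * n by lia.
suff [T [detT <-]] : exists T, det B e T ([:: outer], s)
  (node 0 l :: continuation, started s) /\ T = 7 + 3 * n.+1 by [].
eexists; split.
  apply: det_step => //; rewrite outcome_while (outer_guard rdy le7) go.
  do 2 apply: det_step => //; apply: det_step => //=.
  do 6 apply: det_step => //; rewrite /= minn0; exact: det_refl.
rewrite -[LHS]/(1 + (1 + (1 + (1 + (1 + (n.+1 + (1 + (n.+1 + (1 + (n.+1 + 0)))))))))).
by lia.
Qed.

Lemma started_steps s : ready s -> steps_left (started s) = bud.
Proof. by case=> _ _ bE _; rewrite /steps_left /= /upd /= bE subn0. Qed.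

Lemma started_safe s : ready s -> safe e (started s) (started s).
Proof. by case. Qed.

Lemma node_halts s : ready s ->
  halts_with B e (safe e (started s))
    (n.+1 * (weight (node 0 l) * bud.+1)) ([:: node 0 l], started s).
Proof.
move=> rdy; rewrite -(started_steps rdy) -[X in halts_with _ _ _ X _]add0n.
apply: tame_node => //; first by have := n_leqB; lia.
- exact: started_safe.
- by move=> s' safe' _; apply: halts_with_nil.
Qed.

Lemma safe_ready s s' : ready s -> safe e (started s) s' ->
  ready s' /\ num s' 7 = num s 7.
Proof.
by case=> h0 h2 h4 h6 [h0' reg]; split; [split=> //; rewrite reg|rewrite reg].
Qed.

Definition doubled s : state V := set_num s 7 (2 * num s 7).

Lemma doubled_ready s : ready s -> ready (doubled s).
Proof. by []. Qed.

Lemma continuation_det s : num s 7 < n ->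
  det B e 1 (continuation, s) ([:: outer], doubled s).
Proof.
move=> lt7; apply: (det_next (T := 0)) => //.
suff -> : outcome B e (cnum 7 (emul (econst 2) (ereg 7))) [:: outer] s 0 =
  ([:: outer], doubled s) by apply: det_refl.
rewrite /= minn_cap (minn_idPr _) //; have := n_leqB; lia.
Qed.

Lemma outer_halts L s : ready s -> num s 7 <= 2 * n -> n <= num s 7 * 2 ^ L ->
  halts_with B e (fun s' => num s' 0 != 0 -> has_triangle e)
    (L * attempt_time n X + 1) ([:: outer], s).
Proof.
elim: L s => [|L IH] s rdy le7 leL.
all: have [stop|/norP[]] := boolP ((n <= num s 7) || (num s 0 != 0)).
1,3: apply: (@halts_with_leq _ _ _ _ (1 + 0)); first lia.
1,2: apply: det_halts_with (outer_stop rdy le7 stop) _; apply: halts_with_nil; by case: rdy.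
all: rewrite -ltnNge => lt7 /negPn/eqP n0.
  by move: leL; rewrite expn0 muln1; lia.
have dets := outer_start rdy lt7 n0.
set A := attempt_time n X.
apply: (@halts_with_leq _ _ _ _ (7 + 3 * n.+1 + ((1 + (L * A + 1)) +
  n.+1 * (weight (node 0 l) * bud.+1)))).
  by rewrite /A /attempt_time -/bud; lia.
apply: det_halts_with dets _.
rewrite -(started_steps rdy); apply: tame_node => //; first by have := n_leqB; lia.
- exact: started_safe.
- move=> s' safe' _; have [rdy' e7] := safe_ready rdy safe'.
  apply: (@halts_with_leq _ _ _ _ (1 + (L * A + 1))); first by lia.
  apply: det_halts_with (continuation_det _) _; first by rewrite e7.
  apply: IH; first exact: doubled_ready.
  + by rewrite /= /upd /= e7; lia.
  + by rewrite /= /upd /= e7 -mulnA mulnCA -expnS.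
Qed.

Section Found.
Variable tri : nat -> V.
Hypothesis tri_edge : forall c c', c < 3 -> c' < 3 -> c != c' -> e (tri c) (tri c').
Hypothesis credit_leq : (ecost R V X 0 l + bud%:R * branching R V X 0 l
  * (leaves e tri l (fun=> setT))%:R <= bud%:R / 2)%R.

Lemma node_wp s : ready s ->
  wp B e (bud%:R : R) (fun s' q' => num s' 0 != 0 /\ (0 <= q')%R)
    ([:: node 0 l], started s) (bud%:R / 2)%R.
Proof.
move=> rdy; have [_ r2 r4 r6] := rdy.
have B0 : 0 < B by have := n_leqB; lia.
apply: (wp_node e_sym bud_leqB B0 tri_edge V_gt0 n_leqB l_valid
  (i := 0) (X := X) _ (S := fun=> setT) (E := 0%R)) => //.
- by move=> i' lti'; apply: X_pow_leq.
- by case=> [|[|[|c]]].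
- by rewrite /= /upd /=; move: credit_leq; lra.
- move=> s' q' _ le' found; apply: wp_halt; split.
    by apply: found; rewrite /alive !inE.
  by have := ler0n R (num s' 3); move: le'; lra.
Qed.

(* An attempt fails with probability at most 1/2, so failing from [num s 7 = y] on
   has probability at most [y / n]. *)
Lemma outer_wp L s (q : R) : ready s -> num s 7 <= 2 * n -> 0 < num s 7 ->
  n <= num s 7 * 2 ^ L -> ((num s 7)%:R / n%:R <= q)%R ->
  wp B e 1%R (fun s' q' => (0 <= q')%R /\ answer s' = true) ([:: outer], s) q.
Proof.
have nR : (0 < n%:R :> R)%R by rewrite ltr0n.
have b0 : (0 < bud%:R :> R)%R by rewrite ltr0n /bud /budget addn1.
elim: L s q => [|L IH] s q rdy le7 gt7 leL leq.
all: have q0 : (0 < q)%R by apply: lt_le_trans leq; rewrite divr_gt0 ?ltr0n.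
all: have [ge7|lt7] := leqP n (num s 7).
1,3: by apply: wp_abort; apply: le_trans leq; rewrite ler_pdivlMr // mul1r ler_nat.
  by move: leL; rewrite expn0 muln1; lia.
have [n0|n0] := eqVneq (num s 0) 0; last first.
  apply: det_wp (outer_stop rdy le7 _) _; first by rewrite n0 orbT.
  by apply: wp_halt; rewrite /answer n0; split=> //; apply: ltW.
apply: det_wp (outer_start rdy lt7 n0) _; apply: wp_cons.
(* Rescaling by this factor turns initial credit [bud / 2] and threshold [bud] into [q] and [2 * q]:
   a failed attempt doubles the credit just as register 7 doubles. *)
have z0 : (0 < 2 * q / bud%:R)%R by rewrite divr_gt0 // mulr_gt0.
have := wp_scale z0 (node_wp rdy).
have -> : (bud%:R / 2 * (2 * q / bud%:R) = q)%R by field; rewrite gt_eqF.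
have -> : (bud%:R * (2 * q / bud%:R) = 2 * q)%R by field; rewrite gt_eqF.
move=> H; apply: (wp_halts_with _ (node_halts rdy) H) => s' q' safe'.
  case=> found q'0; have [rdy' e7] := safe_ready rdy safe'.
  apply: det_wp (continuation_det _) _; first by rewrite e7.
  apply: det_wp (outer_stop (doubled_ready rdy') _ _) _.
  - by rewrite /= /upd /= e7; lia.
  - by rewrite /= /upd /= found orbT.
  apply: wp_halt; split; last by rewrite /answer /= /upd /= found.
  by move: q'0; rewrite ler_pdivlMr // mul0r.
move=> leq'; have [rdy' e7] := safe_ready rdy safe'.
apply: det_wp (continuation_det _) _; first by rewrite e7.
apply: IH; first exact: doubled_ready.
- by rewrite /= /upd /= e7; lia.
- by rewrite /= /upd /= e7; lia.
- by rewrite /= /upd /= e7 -mulnA mulnCA -expnS.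
- rewrite /= /upd /= e7 natrM -mulrA; apply: le_trans leq'.
  by rewrite ler_wpM2l.
Qed.

End Found.
End Attempts.
(** Time takes at most a quarter of the budget by the constant 56, and survival another quarter by
    the factor 4 in [admissible]. For [X = 0] the survival term vanishes. *)
Lemma attempt_credit (tri : nat -> V) X : optimal n t X ->
  (0 < m -> leaves e tri l (fun=> setT) <= t) ->
  (ecost R V X 0 l + (budget n X)%:R * branching R V X 0 l
     * (leaves e tri l (fun=> setT))%:R <= (budget n X)%:R / 2)%R.
Proof.
move=> X_opt le_t; set b : R := (budget n X)%:R%R; set L := leaves _ _ _ _.
have nR : (0 < n%:R :> R)%R by rewrite ltr0n.
have H1 : (ecost R V X 0 l <= b / 4)%R.
  apply: le_trans (ecost_leq R V_gt0 (i := 0) (fun i' lti' => X_pow_leq X_opt lti')) _.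
  rewrite expn0 expn1 ler_pdivrMr ?ltr0n; last by lia.
  have : 56 * M * (n * n) <= budget n X * maxn 1 X.
    by rewrite /budget addn1 ltnW // ltn_ceil //; lia.
  rewrite -(ler_nat R) !natrM -/b -expr2; lra.
have b0 : (0 <= b)%R by rewrite /b ler0n.
suff H2 : (branching R V X 0 l * L%:R <= 1 / 4)%R.
  have : (b * (branching R V X 0 l * L%:R) <= b * (1 / 4))%R by rewrite ler_wpM2l.
  by rewrite -mulrA; lra.
have brE := branchingE R X V_gt0 0 l; rewrite expn0 mul1n -/n in brE.
have nM : (0 < n%:R ^+ M :> R)%R by rewrite exprn_gt0.
have {brE} -> : (branching R V X 0 l = (X ^ (2 ^ M).-1)%:R / n%:R ^+ M)%R.
  by rewrite -brE mulfK // gt_eqF.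
rewrite mulrAC ler_pdivrMr // -natrM -natrX.
case/andP: X_opt => /orP[/eqP->|/and3P[m0 _ leX] _].
  rewrite exp0n; first by rewrite mul0n mulr_ge0 // divr_ge0.
  by have := leq_pexp2l (isT : 0 < 2) M_gt0; rewrite expn1; lia.
have mE : m = M by case: mM => // m00; rewrite m00 in m0.
move: leX; rewrite mE.
set z := X ^ _; set w := _ ^ M => leX.
have : 4 * (z * L) <= w.
  apply: leq_trans leX; rewrite -mulnA leq_mul // mulnC leq_mul //.
  exact: le_t.
by rewrite -(ler_nat R) natrM; lra.
Qed.

Lemma budget_expE s X : optimal n t X -> num s 2 = n -> num s 6 = X ->
  neval B s budget_exp = budget n X.
Proof.
move=> X_opt n2 X6.
have lB : 56 * M * (n * n) <= B.
  apply: leq_trans (expN_leq (a := 56 * M + 2) _); last by lia.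
  by rewrite expnD leq_mul ?leq_expN // expnS expn1 leq_mul // /N; lia.
have nB := n_leqB; have XB := X_leq X_opt; have bB := bud_leqB X_opt.
have nn0 : 0 < n * n by rewrite muln_gt0 V_gt0.
rewrite [LHS]/= n2 X6 (minn_cap B n n) minn_cap minn_cap_add (minn_idPr lB).
have -> : minn B (minn B X + minn B (minn B 1 - minn B X)) = maxn 1 X by lia.
by apply/minn_idPr.
Qed.

Lemma outcome_num i a v K s r :
  neval B s a = v -> outcome B e (cnum i a) K s r = (K, set_num s i v).
Proof. by move=> <-. Qed.

Lemma algorithm_correct :
  (forall tri : nat -> V,
     (forall c c', c < 3 -> c' < 3 -> c != c' -> e (tri c) (tri c')) ->
     0 < m -> leaves e tri l (fun=> setT) <= t) ->
  exists X T, [/\ optimal n t X,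
    T = 13 + 4 * n + up_log 2 n * attempt_time n X,
    halts_in algorithm e t T
    & (1 - 1 / n%:R <= answer_prob R algorithm e t T (has_triangle e))%R].
Proof.
move=> le_t; have nB : n <= B by apply: leq_trans n_leqB; apply: leq_pmull.
set s0 := (init_config algorithm V t).2.
pose s3 := set_num (set_num (set_num s0 2 n) 0 0) 4 n.
have [||T0 [s4 [dets leT opt [e0 e1 e2]]]] :=
  @search_spec n s3 _ erefl _ erefl erefl erefl; first exact: leq_subr.
  by left.
set X := num s4 6 in opt.
pose s6 := set_num (set_num s4 4 (budget n X)) 7 1.
have detI : det B e (11 + T0) (init_config algorithm V t) ([:: outer], s6).
  rewrite /init_config -/s0 /=.
  apply: (det_next (T := 10 + T0)) => //; apply: (det_next (T := 9 + T0)) => //.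
  rewrite (@outcome_num _ _ n); last exact/minn_idPr.
  apply: (det_next (T := 8 + T0)) => //; apply: (det_next (T := 7 + T0)) => //.
  rewrite (@outcome_num _ _ 0); last by apply: minn0.
  apply: (det_next (T := 6 + T0)) => //; apply: (det_next (T := 5 + T0)) => //.
  rewrite (@outcome_num _ _ n); last exact/minn_idPr.
  apply: (det_next (T := 4 + T0)) => //; rewrite addnC.
  apply: det_trans (dets _) _.
  apply: (det_next (T := 3)) => //; apply: (det_next (T := 2)) => //.
  rewrite (outcome_num _ _ _ (budget_expE opt e2 erefl)).
  apply: (det_next (T := 1)) => //; apply: (det_next (T := 0)) => //.
  rewrite (@outcome_num _ _ 1); first exact: det_refl.
  by apply/minn_idPr; apply: leq_trans nB.
have rdy : ready X s6.
  by split=> //; rewrite /= /upd /= e0.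
have leL : n <= num s6 7 * 2 ^ up_log 2 n by rewrite mul1n up_logP.
have le7 : num s6 7 <= 2 * n by rewrite /= /upd /=; lia.
have halts := outer_halts opt rdy le7 leL.
exists X, (13 + 4 * n + up_log 2 n * attempt_time n X).
have haltT : halts_with B e (fun s => num s 0 != 0 -> has_triangle e)
    (13 + 4 * n + up_log 2 n * attempt_time n X) (init_config algorithm V t).
  by apply: halts_with_leq (det_halts_with detI halts); lia.
have runs : halts_in algorithm e t (13 + 4 * n + up_log 2 n * attempt_time n X).
  exact: halts_with_runs haltT.
split=> //.
have nR : (0 < n%:R :> R)%R by rewrite ltr0n.
case: (boolP (has_triangle e)) => [hasT|noT].
  have [a /existsP[b /existsP[c /and3P[eab ebc eca]]]] := existsP hasT.
  pose tri i := if i is 0 then a else if i is 1 then b else c.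
  have edge c1 c2 : c1 < 3 -> c2 < 3 -> c1 != c2 -> e (tri c1) (tri c2).
    by case: c1 => [|[|[|//]]] _; case: c2 => [|[|[|//]]] _ //= _; rewrite // e_sym.
  apply: wp_prob_answer runs; last first.
    (* Register 7 starts at 1, so the initial credit is [1 / n]. *)
    apply: det_wp detI _; apply: (outer_wp opt edge _ rdy le7 _ leL) => //.
    exact: attempt_credit opt (le_t tri edge).
  by [].
apply: (@le_trans _ _ (1 - 0)%R); first by rewrite lerD2l lerN2 divr_ge0 // ltW.
(* Without a triangle no run errs, so credit 0 suffices. *)
apply: (wp_prob_answer (Q := fun s q => (0 <= q)%R /\ answer s = false)) runs => //.
apply: halts_with_wp haltT _ => s Ps; split=> //.
by apply/negbTE/negP => /Ps; rewrite (negPf noT).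
Qed.

End Run.
End Main.

(** * Copies of H *)

(** Copies of the part of H induced on [D], coded as total functions with the dummy value [d0]
    elsewhere so that they can be counted. *)
Definition partial_copy (W V : finType) (h : rel W) (e : rel V) (col : W -> 'I_3)
    (d0 : V) (D : {set W}) (S : nat -> {set V}) : {set {ffun W -> V}} :=
  [set phi : {ffun W -> V} |
    [&& [forall x in ~: D, phi x == d0],
        [forall x in D, forall y in D, (phi x == phi y) ==> (x == y)],
        [forall x in D, forall y in D, h x y ==> e (phi x) (phi y)]
      & [forall x in D, phi x \in S (col x)]]].

Lemma partial_copyP (W V : finType) (h : rel W) (e : rel V) (col : W -> 'I_3)
    (d0 : V) (D : {set W}) (S : nat -> {set V}) (phi : {ffun W -> V}) :
  reflect [/\ forall x, x \notin D -> phi x = d0,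
              {in D &, injective phi},
              {in D &, forall x y, h x y -> e (phi x) (phi y)}
            & {in D, forall x, phi x \in S (col x)}]
          (phi \in partial_copy h e col d0 D S).
Proof.
rewrite inE; apply: (iffP and4P) => [[H1 H2 H3 H4]|[H1 H2 H3 H4]]; split.
- by move=> x xD; apply/eqP; apply: (forall_inP H1); rewrite inE.
- move=> x y xD yD Exy; apply/eqP.
  by apply: (implyP (forall_inP (forall_inP H2 x xD) y yD)); rewrite Exy.
- by move=> x y xD yD; apply/implyP; apply: (forall_inP (forall_inP H3 x xD)).
- by move=> x xD; apply: (forall_inP H4).
- by apply/forall_inP => x; rewrite inE => /H1 ->.
- apply/forall_inP => x xD; apply/forall_inP => y yD; apply/implyP => /eqP.
  by move/(H2 x y xD yD) ->.
- by apply/forall_inP => x xD; apply/forall_inP => y yD; apply/implyP; apply: H3.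
- exact/forall_inP.
Qed.

(** Mapping [x] to [v] extends such a copy: the restricted classes avoid [v], and every remaining
    neighbor of [x] has color [c2], whose class lies in the neighborhood of [v]. *)
Lemma partial_copy_extend (W V : finType) (h : rel W) (e : rel V)
    (col : W -> 'I_3) (d0 : V) (D : {set W}) (S : nat -> {set V}) x c2 v :
  symmetric h -> proper_coloring h col -> symmetric e -> irreflexive e ->
  x \in D -> (forall y, y \in D -> h x y -> col y = c2 :> nat) -> v \in S (col x) ->
  #|partial_copy h e col d0 (D :\ x) (restricted e S c2 v)|
    <= #|[set phi in partial_copy h e col d0 D S | phi x == v]|.
Proof.
move=> h_sym h_col e_sym e_irr xD hc2 vS.
pose f (phi : {ffun W -> V}) := [ffun y => if y == x then v else phi y].
have f_inj : {in partial_copy h e col d0 (D :\ x) (restricted e S c2 v) &, injective f}.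
  move=> p1 p2 /partial_copyP[p10 _ _ _] /partial_copyP[p20 _ _ _] /ffunP Ef.
  apply/ffunP => y; have := Ef y; rewrite !ffunE; case: eqP => // -> _.
  by rewrite p10 ?p20 // !inE eqxx.
rewrite -(card_in_imset f_inj); apply: subset_leq_card.
apply/subsetP => _ /imsetP[phi /partial_copyP[phi0 phi_inj phi_e phi_S] ->].
have in_D y : y \in D -> y != x -> y \in D :\ x by rewrite !inE => -> ->.
have neq_v y : y \in D -> y != x -> phi y != v.
  move=> yD nyx; have := phi_S y (in_D y yD nyx); rewrite /restricted.
  case: ifP => _; rewrite !inE => /andP[] //.
  by move=> _; apply: contraTneq => ->; rewrite e_irr.
rewrite inE ffunE !eqxx andbT; apply/partial_copyP; split.
- move=> y yD; rewrite ffunE ifN ?phi0 //; first by rewrite !inE negb_and yD orbT.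
  by apply: contraNneq yD => ->.
- move=> y z yD zD; rewrite !ffunE.
  case: (eqVneq y x) => [->|nyx]; case: (eqVneq z x) => [->|nzx] //.
  + by move=> Ev; have := neq_v z zD nzx; rewrite -Ev eqxx.
  + by move=> Ev; have := neq_v y yD nyx; rewrite Ev eqxx.
  + by apply: phi_inj; apply: in_D.
- have edge_v y : y \in D -> y != x -> h x y -> e v (phi y).
    move=> yD nyx hxy; have := phi_S y (in_D y yD nyx).
    by rewrite /restricted (hc2 y yD hxy) eqxx !inE => /andP[].
  move=> y z yD zD hyz; rewrite !ffunE; move: hyz.
  case: (eqVneq y x) => [->|nyx]; case: (eqVneq z x) => [->|nzx] hyz.
  + by have := h_col _ _ hyz; rewrite eqxx.
  + exact: edge_v.
  + by rewrite e_sym; apply: edge_v; rewrite // h_sym.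
  + by apply: phi_e hyz; apply: in_D.
- move=> y yD; rewrite ffunE; case: (eqVneq y x) => [->|nyx] //.
  have := phi_S y (in_D y yD nyx); rewrite /restricted.
  by case: ifP => _; rewrite !inE => /andP[].
Qed.

(** Each deletion yields the pair of the color of [x] and that of its remaining neighbors, and
    different choices of [v] give different copies. On the leftover clique, [x |-> tri (col x)] is
    injective because the coloring is proper. *)
Lemma deletes_to_levels (W : finType) (h : rel W) (col : W -> 'I_3) (D D' : {set W}) :
  symmetric h -> proper_coloring h col -> deletes_to h col D D' ->
  {in D' &, forall x y, x != y -> h x y} ->
  exists l, [/\ valid_levels l, size l + #|D'| = #|D|
    & forall (V : finType) (e : rel V) (tri : nat -> V) (S : nat -> {set V}),
      symmetric e -> irreflexive e ->
      (forall c c', c < 3 -> c' < 3 -> c != c' -> e (tri c) (tri c')) ->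
      leaves e tri l S <= #|partial_copy h e col (tri 0) D S|].
Proof.
move=> h_sym h_col; elim=> {D D'} [D|D D' x xD mono _ IH] clique.
  exists [::]; split=> // V e tri S e_sym e_irr tri_edge /=.
  case: (boolP (alive tri S)) => // /aliveP al.
  apply/card_gt0P; exists [ffun x => if x \in D then tri (col x) else tri 0].
  have edge x y : x \in D -> y \in D -> h x y -> e (tri (col x)) (tri (col y)).
    by move=> xD yD hxy; apply: tri_edge => //; rewrite (inj_eq (@ord_inj 3)); apply: h_col.
  apply/partial_copyP; split.
  - by move=> x xD; rewrite ffunE (negPf xD).
  - move=> x y xD yD; rewrite !ffunE xD yD; have [//|nxy] := eqVneq x y.
    by move=> Exy; have := edge x y xD yD (clique x y xD yD nxy); rewrite Exy e_irr.
  - by move=> x y xD yD; rewrite !ffunE xD yD; apply: edge.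
  - by move=> x xD; rewrite ffunE xD; apply: al.
have [l [val_l size_l le_l]] := IH clique.
have [c2 [lt2 n12 hc2]] : exists c2 : nat, [/\ c2 < 3, col x != c2 :> nat
    & forall y, y \in D -> h x y -> col y = c2 :> nat].
  have [/existsP[y /andP[yD hxy]]|] := boolP [exists y in D, h x y].
    exists (col y); split=> //; first by rewrite (inj_eq (@ord_inj 3)); apply: h_col.
    by move=> z zD hxz; congr (nat_of_ord _); apply: mono.
  rewrite negb_exists => /forallP nh.
  (* If no neighbor of [x] remains, any color other than that of [x] serves. *)
  exists ((col x).+1 %% 3); split; first exact: ltn_pmod.
    by case: (col x) => -[|[|[|]]].
  by move=> y yD hxy; have := nh y; rewrite yD hxy.
exists ((nat_of_ord (col x), c2) :: l); split.
- by rewrite /= ltn_ord lt2 n12.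
- by rewrite /= addSn size_l (cardsD1 x D) xD.
move=> V e tri S e_sym e_irr tri_edge /=.
apply: (@leq_trans (\sum_(v in S (col x))
    #|[set phi in partial_copy h e col (tri 0) D S | phi x == v]|)).
  apply: leq_sum => v vS; apply: leq_trans (le_l _ _ _ _ e_sym e_irr tri_edge) _.
  exact: partial_copy_extend.
rewrite -[X in _ <= X]sum1_card.
rewrite (partition_big (fun phi : {ffun W -> V} => phi x) (mem (S (col x)))) /=; last first.
  by move=> phi /partial_copyP[_ _ _]; apply.
by apply: leq_sum => v _; rewrite -sum1_card; apply/eq_leq/eq_bigl => phi; rewrite inE.
Qed.

Lemma partial_copy_full (k : nat) (h : rel 'I_k) (V : finType) (e : rel V)
    (col : 'I_k -> 'I_3) (d0 : V) :
  #|partial_copy h e col d0 setT (fun=> setT)| <= num_copies h e.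
Proof.
apply: subset_leq_card; apply/subsetP => phi /partial_copyP[_ phi_inj phi_e _].
rewrite inE; apply/andP; split; first by apply/injectiveP => x y; apply: phi_inj.
by apply/forallP => x; apply/forallP => y; apply/implyP; apply: phi_e.
Qed.

(** Each vertex of a triangle sees two colors as long as the other two are present, so none of them
    can be the first to be deleted. *)
Lemma triangle_survives (W : finType) (h : rel W) (col : W -> 'I_3)
    (D D' : {set W}) (x y z : W) :
  symmetric h -> proper_coloring h col -> deletes_to h col D D' ->
  h x y -> h y z -> h z x -> [/\ x \in D, y \in D & z \in D] -> x \in D'.
Proof.
move=> h_sym h_col del hxy hyz hzx.
elim: del => {D D'} [D|D D' w wD mono _ IH] [xD yD zD] //.
apply: IH; split; rewrite !inE ?xD ?yD ?zD andbT.
- apply: contraTneq (h_col _ _ hyz) => wx; rewrite negbK.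
  by apply/eqP; apply: mono; rewrite // -wx // h_sym.
- apply: contraTneq (h_col _ _ hzx) => wy; rewrite negbK.
  by apply/eqP; apply: mono; rewrite // -wy // h_sym.
- apply: contraTneq (h_col _ _ hxy) => wz; rewrite negbK.
  by apply/eqP; apply: mono; rewrite // -wz // h_sym.
Qed.

Lemma nice_levels (k : nat) (h : rel 'I_k) :
  simple_graph h -> has_nice_coloring h ->
  exists l, [/\ valid_levels l, k = size l + 3 * has_triangle h
    & forall (V : finType) (e : rel V) (tri : nat -> V),
      symmetric e -> irreflexive e ->
      (forall c c', c < 3 -> c' < 3 -> c != c' -> e (tri c) (tri c')) ->
      leaves e tri l (fun=> setT) <= num_copies h e].
Proof.
move=> [h_sym h_irr] [col [h_col [D' [del _ left]]]].
have clique : {in D' &, forall x y, x != y -> h x y}.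
  by case: left => [->|[_ clq]] x y xD yD; [rewrite inE in xD|apply: clq].
have [l [val_l size_l le_l]] := deletes_to_levels h_sym h_col del clique.
exists l; split=> //; last first.
  move=> V e tri e_sym e_irr tri_edge.
  exact: leq_trans (le_l V e tri (fun=> setT) e_sym e_irr tri_edge) (partial_copy_full _ _ _ _).
rewrite cardsT card_ord in size_l.
suff -> : 3 * has_triangle h = #|D'| by [].
case: left => [D0|[D3 clq]].
  rewrite D0 cards0; case: (boolP (has_triangle h)) => // /existsP[x /existsP[y /existsP[z]]].
  move=> /and3P[hxy hyz hzx]; have := triangle_survives h_sym h_col del hxy hyz hzx.
  by rewrite D0 !inE => /(_ (And3 isT isT isT)).
rewrite D3; have -> // : has_triangle h.
have /card_gt0P[x xD] : 0 < #|D'| by rewrite D3.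
have /card_gt0P[y] : 0 < #|D' :\ x| by move: D3; rewrite (cardsD1 x D') xD; lia.
rewrite !inE => /andP[nyx yD].
have /card_gt0P[z] : 0 < #|D' :\ x :\ y|.
  by move: D3; rewrite (cardsD1 x D') xD (cardsD1 y (D' :\ x)) !inE nyx yD; lia.
rewrite !inE => /and3P[nzy nzx zD].
apply/existsP; exists x; apply/existsP; exists y; apply/existsP; exists z.
by rewrite !clq // eq_sym.
Qed.

(** * The running time *)

Lemma time_boundE (R : realType) (m : nat) (tri : bool) (n t : R) :
  (time_bound (m + 3 * tri) tri n t =
   n `^ (3 - 1 / 2 `^ (m%:R - 1))
   + n `^ (3 - m%:R / (2 `^ m%:R - 1)) * t `^ (1 / (2 `^ m%:R - 1)))%R.
Proof.
rewrite /time_bound; case: tri; rewrite ?muln1 ?muln0 ?addn0 // natrD.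
have -> : (m%:R + 3 - 4 = m%:R - 1 :> R)%R by ring.
by have -> : (m%:R + 3 - 3 = m%:R :> R)%R by ring.
Qed.

Lemma root_leq (R : realType) (x y : R) (b : nat) : 0 < b ->
  (0 <= x -> 0 <= y -> x <= y ^+ b -> x `^ (1 / b%:R) <= y)%R.
Proof.
move=> b0 x0 y0 lexy; have bR : (b%:R != 0 :> R)%R by rewrite pnatr_eq0 -lt0n.
have yE : (y = (y ^+ b) `^ (1 / b%:R))%R.
  by rewrite -powR_mulrn // -powRrM mulrC divfK // powRr1.
by rewrite [X in (_ <= X)%R]yE; apply: ge0_ler_powR; rewrite ?nnegrE ?exprn_ge0 // divr_ge0.
Qed.

(** As [X + 1] is not admissible and is at most [2 * maxn 1 X], one of the two violated conditions
    bounds [X] below, and each matches one term. The 8 is [4 * 2], the factor 4 of [admissible]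
    being absorbed through [4 <= 4 ^ b]. *)
Lemma time_bound_geq (R : realType) (m n t X : nat) (tri : bool) :
  0 < n -> optimal m n t X ->
  (n%:R ^+ 3 / (maxn 1 X)%:R
   <= 8 * time_bound (m + 3 * tri) tri (n%:R : R) t%:R)%R.
Proof.
move=> n0 /andP[_ nadm]; rewrite time_boundE.
have nR : (0 < n%:R :> R)%R by rewrite ltr0n.
have nn : (n%:R != 0 :> R)%R by rewrite gt_eqF.
set Y := maxn 1 X; have Y0 : (0 < Y%:R :> R)%R by rewrite ltr0n /Y; lia.
have Y1 : (1 <= Y%:R :> R)%R by rewrite ler1n /Y; lia.
have n3E : (n%:R `^ 3 = n%:R ^+ 3 :> R)%R by rewrite -powR_mulrn // ltW.
case: m nadm => [_|m nadm].
  (* For [m = 0] both exponents have denominator 0, hence are 0, and the second summand is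
     [n ^ 3]. *)
  rewrite powRr0 subrr invr0 !mulr0 subr0 powRr0 mulr1 n3E.
  have H1 : (n%:R ^+ 3 / Y%:R <= n%:R ^+ 3 :> R)%R.
    by rewrite ler_pdivrMr // ler_peMr // exprn_ge0 // ltW.
  have H2 := powR_ge0 (n%:R : R) (3 - 1 / 2 `^ (0%:R - 1)).
  have : (0 <= n%:R ^+ 3 :> R)%R by rewrite exprn_ge0 // ltW.
  by move: H1 H2; lra.
have -> : (2 `^ (m.+1%:R - 1) = (2 ^ m)%:R :> R)%R.
  by rewrite -[(m.+1%:R)%R]natr1 addrK powR_mulrn // natrX.
have p2 : 0 < 2 ^ m.+1 by rewrite expn_gt0.
have -> : (2 `^ m.+1%:R - 1 = ((2 ^ m.+1).-1)%:R :> R)%R.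
  by rewrite powR_mulrn // -natrX -subn1 natrB.
set a := 2 ^ m; set b := (2 ^ m.+1).-1.
have a0 : 0 < a by rewrite expn_gt0.
have b0 : 0 < b by rewrite /b expnS; move: a0; rewrite /a; lia.
set T1 := (n%:R `^ _)%R; set T2 := (n%:R `^ _ * _)%R.
have T10 : (0 <= T1)%R by apply: powR_ge0.
have T20 : (0 <= T2)%R by rewrite mulr_ge0 // powR_ge0.
have X2Y : X.+1 <= 2 * Y by rewrite /Y; lia.
move: nadm; rewrite /admissible /= -/a -/b negb_and -!ltnNge => /orP[ltn|ltn].
- have H : (n%:R `^ (1 / a%:R) <= 2 * Y%:R :> R)%R.
    apply: root_leq => //; first by rewrite mulr_ge0 // ltW.
    rewrite -natrM -natrX ler_nat; apply: leq_trans (ltnW ltn) _.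
    exact: leq_powr.
  have T1E : (T1 * n%:R `^ (1 / a%:R) = n%:R ^+ 3)%R.
    by rewrite /T1 -powRD ?nn ?implybT // subrK n3E.
  rewrite ler_pdivrMr // -T1E.
  have : (T1 * n%:R `^ (1 / a%:R) <= T1 * (2 * Y%:R))%R by rewrite ler_wpM2l.
  have : (0 <= T1 * Y%:R)%R by rewrite mulr_ge0 // ltW.
  have : (0 <= T2 * Y%:R)%R by rewrite mulr_ge0 // ltW.
  by lra.
- have bR : (b%:R != 0 :> R)%R by rewrite pnatr_eq0 -lt0n.
  have t0 : 0 < t by case: (posnP t) ltn => // ->; rewrite muln0 mul0n ltn0.
  set u := (t%:R `^ (1 / b%:R) : R)%R in T2 T20 *.
  have u0 : (0 <= u)%R by apply: powR_ge0.
  have ub : (u ^+ b = t%:R)%R.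
    by rewrite -powR_mulrn // -powRrM divfK // powRr1.
  have H : (n%:R `^ (m.+1%:R / b%:R) <= 8 * u * Y%:R :> R)%R.
    have -> : (m.+1%:R / b%:R = m.+1%:R * (1 / b%:R) :> R)%R by rewrite mulrA mulr1.
    rewrite powRrM powR_mulrn ?ler0n //; apply: root_leq => //.
    + by rewrite exprn_ge0 // ltW.
    + by rewrite !mulr_ge0 // ltW.
    have -> : (8 * u * Y%:R = 4 * (2 * (u * Y%:R)))%R by ring.
    rewrite !exprMn ub.
    have H4 : (4 <= 4%:R ^+ b :> R)%R by rewrite -natrX ler_nat -{1}(expn1 4) leq_pexp2l.
    have H5 : (n%:R ^+ m.+1 <= 4 * (t%:R * (2 * Y%:R) ^+ b) :> R)%R.
      rewrite -natrX -natrM -natrX -!natrM ler_nat mulnA.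
      by apply: leq_trans (ltnW ltn) _; rewrite leq_mul // leq_powr.
    apply: le_trans H5 _.
    have -> : (2 ^+ b * (t%:R * Y%:R ^+ b) = t%:R * (2 * Y%:R) ^+ b :> R)%R.
      by rewrite exprMn mulrCA.
    by rewrite ler_wpM2r // mulr_ge0 // exprn_ge0 // mulr_ge0 // ltW.
  set T3 := (n%:R `^ (3 - _))%R in T2 T20 *.
  have T30 : (0 <= T3)%R by apply: powR_ge0.
  have T3E : (T3 * n%:R `^ (m.+1%:R / b%:R) = n%:R ^+ 3)%R.
    by rewrite /T3 -powRD ?nn ?implybT // subrK n3E.
  rewrite ler_pdivrMr // -T3E.
  have : (T3 * n%:R `^ (m.+1%:R / b%:R) <= T3 * (8 * u * Y%:R))%R by rewrite ler_wpM2l.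
  have : (0 <= T1 * Y%:R)%R by rewrite mulr_ge0 // ltW.
  by rewrite /T2; lra.
Qed.

Lemma up_log_leq_ln (R : realType) (n : nat) : 0 < n ->
  (1 + (up_log 2 n)%:R <= (2 + 1 / ln 2) * (1 + ln (n%:R : R)))%R.
Proof.
move=> n0; have ln2 : (0 < ln 2 :> R)%R by rewrite ln_gt0 // ltr1n.
have lnn : (0 <= ln (n%:R : R))%R by rewrite ln_ge0 // ler1n.
have i2 : (0 < 1 / ln 2 :> R)%R by rewrite divr_gt0.
have lnE : (ln (n%:R : R) = ln (n%:R : R) / ln 2 * ln 2)%R by rewrite divfK // gt_eqF.
have H : ((up_log 2 n)%:R <= 1 + ln (n%:R : R) / ln 2)%R.
  have [n1|n1] := leqP n 1.
    have -> : n = 1 by lia.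
    by rewrite up_log1 ln1 mul0r addr0.
  have L0 : 0 < up_log 2 n by rewrite up_log_gt0.
  have := up_log_gtn (isT : 1 < 2) n1; rewrite -(prednK L0) -natr1 /=.
  move: (up_log 2 n).-1 => L ltL.
  rewrite addrC lerD2l ler_pdivlMr // mulr_natl -lnXn // -natrX.
  by rewrite ler_ln ?posrE ?ltr0n ?expn_gt0 // ler_nat ltnW.
have -> : ((2 + 1 / ln 2) * (1 + ln (n%:R : R))
  = 2 + 1 / ln 2 + 2 * ln n%:R + ln n%:R / ln 2)%R by ring.
by lra.
Qed.

(** In [31 = 14 + 17], the 14 is [8 + 3 * 2] from the set-up of an attempt, with [n + 1 <= 2 * n],
    and the 17 is [13 + 4] from initialization and search. *)
Lemma total_time_leq (R : realType) (l : seq (nat * nat)) (n X L : nat) :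
  0 < n -> X <= n ->
  ((13 + 4 * n + L * attempt_time l n X)%:R
   <= (31 + 2 * (weight (node 0 l))%:R * (56 * (size l)%:R + 2))
      * (1 + L%:R) * (n%:R ^+ 3 / (maxn 1 X)%:R) :> R)%R.
Proof.
move=> n0 Xn; set w := weight _; set M := size l; set Y := maxn 1 X.
have Y0 : (0 < Y%:R :> R)%R by rewrite ltr0n /Y; lia.
set N : R := (n%:R)%R; have N1 : (1 <= N)%R by rewrite /N ler1n.
set z : R := (N ^+ 2 / Y%:R)%R.
have YN : (Y%:R <= N)%R by rewrite /N ler_nat /Y; lia.
have zN : (N <= z)%R by rewrite /z ler_pdivlMr // expr2 ler_wpM2l //; lra.
have -> : (N ^+ 3 / Y%:R = N * z)%R by rewrite /z exprS mulrA.
have Nz : (N <= N * z)%R by rewrite ler_peMr; lra.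
have bud_le : ((budget l n X).+1%:R <= (56 * M%:R + 2) * z)%R.
  have : ((56 * M * (n * n) %/ Y)%N%:R <= 56 * M%:R * z)%R.
    rewrite /z mulrA ler_pdivlMr //.
    have -> : (56 * M%:R * N ^+ 2 = (56 * M * (n * n))%:R)%R.
      by rewrite /N expr2 !natrM.
    by rewrite -natrM ler_nat leq_divM.
  by rewrite /budget -/Y -/M addn1 -!natr1; lra.
have w0 : (0 <= w%:R :> R)%R by rewrite ler0n.
have M0 : (0 <= M%:R :> R)%R by rewrite ler0n.
have L0 : (0 <= L%:R :> R)%R by rewrite ler0n.
have n1E : (n.+1%:R = N + 1 :> R)%R by rewrite -natr1.
have H1 : ((attempt_time l n X)%:R <= (14 + 2 * w%:R * (56 * M%:R + 2)) * (N * z))%R.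
  rewrite /attempt_time -/w natrD (natrD _ 8) !natrM n1E.
  set b : R := ((budget l n X).+1%:R)%R in bud_le *.
  have : (w%:R * b <= w%:R * ((56 * M%:R + 2) * z))%R by rewrite ler_wpM2l.
  set p := (w%:R * b)%R; set r := (w%:R * _)%R => lepr.
  have b0 : (0 <= b)%R by rewrite ler0n.
  have p0 : (0 <= p)%R by rewrite mulr_ge0.
  have : ((N + 1) * p <= 2 * N * r)%R by rewrite ler_pM //; lra.
  by rewrite /r; lra.
have K0 : (0 <= 14 + 2 * w%:R * (56 * M%:R + 2) :> R)%R.
  by rewrite addr_ge0 // !mulr_ge0 // addr_ge0 // mulr_ge0.
set k : R := (14 + 2 * w%:R * (56 * M%:R + 2))%R in H1 K0.
have H2 : (L%:R * (attempt_time l n X)%:R <= L%:R * (k * (N * z)))%R by rewrite ler_wpM2l.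
have H3 : (0 <= L%:R * (N * z))%R by rewrite mulr_ge0 //; lra.
have H4 : (0 <= k * (N * z))%R by rewrite mulr_ge0 //; lra.
rewrite !natrD !natrM -/N.
have -> : ((31 + 2 * w%:R * (56 * M%:R + 2)) = k + 17)%R by rewrite /k; ring.
by lra.
Qed.

Local Open Scope ring_scope.

Theorem theorem1p11 (R : realType) (k : nat) (h : rel 'I_k)
    (h_graph : simple_graph h) (h_nice : has_nice_coloring h) :
  exists (P : program) (C D : R) (d : nat),
    forall (V : finType) (e : rel V) (t : nat),
      (0 < #|V|)%N -> simple_graph e -> (num_copies h e <= t)%N ->
      exists T : nat,
        [/\ T%:R <= C * (1 + ln (#|V|%:R : R)) ^+ d
                    * time_bound k (has_triangle h) (#|V|%:R : R) t%:R,
            halts_in P e t T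
          & 1 - D / #|V|%:R <= answer_prob R P e t T (has_triangle e)].
Proof.
have [l [val_l kE le_l]] := nice_levels h_graph h_nice.
(* Without levels, [X = 0] and one level amounts to exhaustive search. *)
pose l' := if l is [::] then [:: (0, 1)%N] else l.
have val_l' : valid_levels l' by rewrite /l'; case: (l) val_l.
have l'_gt0 : (0 < size l')%N by rewrite /l'; case: (l).
have ml' : size l = 0%N \/ size l = size l' by rewrite /l'; case: (l); [left|right].
pose K : R := 31 + 2 * (weight (node 0 l'))%:R * (56 * (size l')%:R + 2).
exists (algorithm (size l) l'), (8 * K * (2 + 1 / ln 2)), 1, 1%N.
move=> V e t V0 [e_sym e_irr] le_t.
have le_t' (tri : nat -> V) :
    (forall c c', (c < 3)%N -> (c' < 3)%N -> c != c' -> e (tri c) (tri c')) ->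
    (0 < size l)%N -> (leaves e tri l' (fun=> setT) <= t)%N.
  move=> tri_edge l0; apply: leq_trans le_t.
  have -> : l' = l by rewrite /l'; case: (l) l0.
  exact: le_l.
have [X [T [X_opt TE halts prob]]] :=
  algorithm_correct R V0 e_sym val_l' l'_gt0 ml' le_t'.
exists T; split=> //.
set n := #|V| in V0 X_opt TE *.
have Xn : (X <= n)%N by apply: (X_leq V0 val_l' l'_gt0 ml' X_opt).
have K0 : 0 <= K by rewrite addr_ge0 // !mulr_ge0 // addr_ge0 // mulr_ge0.
have H1 := total_time_leq R l' (up_log 2 n) V0 Xn.
have H2 := up_log_leq_ln R V0.
have := time_bound_geq R (has_triangle h) V0 X_opt; rewrite -kE => H3.
have Y0 : 0 <= n%:R ^+ 3 / (maxn 1 X)%:R :> R by rewrite divr_ge0 // exprn_ge0.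
rewrite TE expr1; apply: le_trans H1 _; rewrite -/K.
have -> : 8 * K * (2 + 1 / ln 2) * (1 + ln (n%:R : R))
    * time_bound k (has_triangle h) n%:R t%:R =
  K * ((2 + 1 / ln 2) * (1 + ln n%:R)) * (8 * time_bound k (has_triangle h) n%:R t%:R).
  by ring.
apply: ler_pM => //; first by rewrite mulr_ge0 // addr_ge0.
by rewrite ler_wpM2l.
Qed.
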